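(* Let $\Delta$ be a pointed rational fan in $N_{\mathbb R}$, let $X\subset Y_\Delta$ be a closed subscheme, let $K'\supset K$ be a valued extension field, and let $\pi\colon X_{K'}^{\mathrm{an}}\to X^{\mathrm{an}}$ be the structural map. Then $\pi(S_{\mathrm{Trop}}(X_{K'}))=S_{\mathrm{Trop}}(X)$.
   Context: $K$ is a field complete with respect to a (possibly trivial) non-Archimedean valuation. A valued extension field of $K$ is a complete non-Archimedean field $K'\supset K$ whose valuation restricts to that of $K$. $X_{K'}$ denotes extension of scalars. $M\cong\mathbb Z^n$, $N=\mathrm{Hom}(M,\mathbb Z)$, $N_{\mathbb R}=N\otimes\mathbb R$, $T=\mathrm{Spec}(K[M])$ with characters $\chi^u$, $u\in M$. $Y_\Delta$ is the toric variety over $K$ of $\Delta$ with dense torus $T$; as a set $Y_\Delta=\bigsqcup_{\sigma\in\Delta}O(\sigma)$ with torus orbits $O(\sigma)=\mathrm{Spec}(K[\sigma^\perp\cap M])$. Put $N_{\mathbb R}(\sigma)=N_{\mathbb R}/\langle\sigma\rangle$, where $\langle\sigma\rangle$ is the linear span. $\overline N{}^\Delta_{\mathbb R}=\bigsqcup_{\sigma\in\Delta}N_{\mathbb R}(\sigma)$ is the Kajiwara--Payne partial compactification of $N_{\mathbb R}$, where $\omega\in N_{\mathbb R}(\tau)$, $\tau\prec\sigma$, is identified with the monoid homomorphism $\sigma^\vee\cap M\to\mathbb R\cup\{\infty\}$ given by $u\mapsto\langle u,\omega\rangle$ if $u\in\tau^\perp$ and $u\mapsto\infty$ otherwise. $Y^{\mathrm{an}}$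 denotes Berkovich analytification (over the relevant ground field). The map $\mathrm{trop}\colon Y_\Delta^{\mathrm{an}}\to\overline N{}^\Delta_{\mathbb R}$ is given by $\langle u,\mathrm{trop}(\xi)\rangle=-\log|\chi^u(\xi)|$. For $\omega\in\mathrm{trop}(X^{\mathrm{an}})\cap N_{\mathbb R}(\sigma)$, $X_\omega=\mathrm{trop}^{-1}(\omega)\cap X^{\mathrm{an}}$ is an affinoid domain in $(X\cap O(\sigma))^{\mathrm{an}}$. The Shilov boundary of an affinoid space $\mathscr M(\mathcal A)$ is the (finite) smallest subset on which every $|f|$, $f\in\mathcal A$, attains its maximum. The tropical skeleton is $S_{\mathrm{Trop}}(X)=\{\xi\in X^{\mathrm{an}}\mid\xi\text{ is a Shilov boundary point of }X_{\mathrm{trop}(\xi)}\}$; $S_{\mathrm{Trop}}(X_{K'})$ is defined in the same way over $K'$. *)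

(* Defs.v *)
From HB Require Import structures.
From mathcomp Require Import all_boot all_order all_algebra finmap.
From mathcomp.multinomials Require Import monalg.
From mathcomp Require Import all_classical all_reals all_analysis.
From mathcomp Require Import summability.

Set Implicit Arguments.
Unset Strict Implicit.
Unset Printing Implicit Defensive.

Import Order.TTheory GRing.Theory Num.Theory.
Import numFieldNormedType.Exports.

Local Open Scope classical_set_scope.
Local Open Scope ring_scope.

(* monalg.v only equips {malg K[P]} with a product when P is a multiplicative
   monoid without nontrivial units, which excludes the character lattice; here
   P is any additive commutative monoid and << c *g u >> stands for c chi^u. *)
Definition monoidAlg (K : fieldType) (P : nmodType) : Type := {malg K[P]}.

Section MonoidAlg.
Variables (K : fieldType) (P : nmodType).
Local Notation A := (monoidAlg K P).

HB.instance Definition _ := GRing.Lmodule.on A.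

Implicit Types (f g : A) (u : P) (c : K).

Definition malg_one : A := << 1 *g 0 >>.

Definition malg_mul f g : A :=
  \sum_(u <- msupp f) \sum_(w <- msupp g) << f@_u * g@_w *g u + w >>.

Let malg_mulw (d e : {fset P}) f g :
  (msupp f `<=` d)%fset -> (msupp g `<=` e)%fset ->
  malg_mul f g = \sum_(u <- d) \sum_(w <- e) << f@_u * g@_w *g u + w >>.
Proof.
move=> fd ge; rewrite /malg_mul (big_fset_incl _ fd) /=.
  apply/eq_bigr=> u _; apply/big_fset_incl => // k _ /mcoeff_outdom ->.
  by rewrite mulr0 monalgU0.
move=> k _ /mcoeff_outdom fk.
by rewrite big1 // => k' _; rewrite fk mul0r monalgU0.
Qed.

Let malg_mulC f g : malg_mul f g = malg_mul g f.
Proof.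
rewrite /malg_mul exchange_big /=; apply/eq_bigr=> w _; apply/eq_bigr=> u _.
by rewrite mulrC addrC.
Qed.

Let malg_mulDl f1 f2 g : malg_mul (f1 + f2) g = malg_mul f1 g + malg_mul f2 g.
Proof.
rewrite (malg_mulw (msuppD_le f1 f2) (fsubset_refl _)).
rewrite (malg_mulw (fsubsetUl (msupp f1) (msupp f2)) (fsubset_refl _)).
rewrite (malg_mulw (fsubsetUr (msupp f1) (msupp f2)) (fsubset_refl _)).
rewrite -big_split /=; apply/eq_bigr=> u _.
rewrite -big_split /=; apply/eq_bigr=> w _.
by rewrite mcoeffD mulrDl monalgUD.
Qed.

Let malg_mulDr f g1 g2 : malg_mul f (g1 + g2) = malg_mul f g1 + malg_mul f g2.
Proof. by rewrite !(malg_mulC f) malg_mulDl. Qed.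

Let malg_mul0 f : malg_mul f 0 = 0.
Proof. by rewrite malg_mulC /malg_mul msupp0 big_seq_fset0. Qed.

Let malg_0mul f : malg_mul 0 f = 0.
Proof. by rewrite malg_mulC malg_mul0. Qed.

Let malg_mulUU a b u w :
  malg_mul << a *g u >> << b *g w >> = << a * b *g u + w >>.
Proof. by rewrite (malg_mulw msuppU_le msuppU_le) !big_seq_fset1 !mcoeffUU. Qed.

Let malg_mulZl c f g : c *: malg_mul f g = malg_mul (c *: f) g.
Proof.
rewrite (malg_mulw (msuppZ_le c f) (fsubset_refl _)) /malg_mul scaler_sumr.
apply/eq_bigr=> u _; rewrite scaler_sumr; apply/eq_bigr=> w _.
apply/malgP => k.
by rewrite [LHS]mcoeffZ mcoeffZ !mcoeffU mulrnAr mulrA.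
Qed.

Let malg_sum_mul (I : Type) (r : seq I) (F : I -> A) g :
  malg_mul (\sum_(i <- r) F i) g = \sum_(i <- r) malg_mul (F i) g.
Proof.
exact: (big_morph (malg_mul^~ g) (fun _ _ => malg_mulDl _ _ _) (malg_0mul g)).
Qed.

Let malg_mul_sum (I : Type) (r : seq I) (F : I -> A) f :
  malg_mul f (\sum_(i <- r) F i) = \sum_(i <- r) malg_mul f (F i).
Proof.
exact: (big_morph (malg_mul f) (fun _ _ => malg_mulDr _ _ _) (malg_mul0 f)).
Qed.

Let malg_mul1 f : malg_mul malg_one f = f.
Proof.
rewrite [f]monalgE malg_mul_sum; apply/eq_bigr=> u _.
by rewrite malg_mulUU mul1r add0r.
Qed.

Let malg_mulA f g h : malg_mul f (malg_mul g h) = malg_mul (malg_mul f g) h.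
Proof.
rewrite [f]monalgE (malg_sum_mul _ _ g) (malg_sum_mul _ _ h) malg_sum_mul.
apply/eq_bigr=> u _; set x : A := << _ *g u >>.
rewrite [g]monalgE (malg_sum_mul _ _ h) !(malg_mul_sum _ _ x) (malg_sum_mul _ _ h).
apply/eq_bigr=> w _; set y : A := << _ *g w >>.
rewrite [h]monalgE (malg_mul_sum _ _ y) (malg_mul_sum _ _ x).
rewrite (malg_mul_sum _ _ (malg_mul x y)); apply/eq_bigr=> k _.
by rewrite !malg_mulUU mulrA addrA.
Qed.

Let malg_one_neq0 : malg_one != 0.
Proof.
by apply/eqP/malgP => /(_ 0) /eqP; rewrite mcoeffUU mcoeff0 oner_eq0.
Qed.

HB.instance Definition _ := GRing.Zmodule_isComNzRing.Build A
  malg_mulA malg_mulC malg_mul1 malg_mulDl malg_one_neq0.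
HB.instance Definition _ := GRing.Lmodule_isLalgebra.Build K A malg_mulZl.
HB.instance Definition _ := GRing.Lalgebra_isComAlgebra.Build K A.

End MonoidAlg.

(* For submonoids S and T of M, the K-linear map K[S] -> K[T] with
   chi^u |-> chi^u if u \in T and chi^u |-> 0 otherwise. It is the inclusion
   when S is contained in T. *)
Definition malg_restr (K : fieldType) (M : choiceType) (S T : pred M)
    (s : subChoiceType S) (t : subChoiceType T)
    (f : {malg K[s]}) : {malg K[t]} :=
  \sum_(u <- msupp f)
    if insub (val u) is Some u' then << f@_u *g u' >> else 0.

Definition malg_scal (K K' : fieldType) (iota : {rmorphism K -> K'})
    (P : nmodType) (f : monoidAlg K P) : monoidAlg K' P :=
  \sum_(u <- msupp f) << iota f@_u *g u >>.

Section Ideals.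
Variable A : comNzRingType.

(* The unit ideal is allowed, unlike in ring_quotient.v. *)
Definition is_ideal (I : set A) : Prop :=
  [/\ I 0, forall f g, I f -> I g -> I (f + g) & forall a f, I f -> I (a * f)].

Definition ideal_gen (E : set A) : set A := smallest is_ideal E.

End Ideals.

Section Valuation.
Variables (R : realType) (K : fieldType).

Record nonarch_abs (v : K -> R) : Prop := NonarchAbs {
  nonarch_abs_ge0 : forall x, 0 <= v x;
  nonarch_abs_eq0 : forall x, v x = 0 <-> x = 0;
  nonarch_absM : forall x y, v (x * y) = v x * v y;
  nonarch_absD : forall x y, v (x + y) <= Num.max (v x) (v y) }.

Definition abs_complete (v : K -> R) : Prop :=
  forall s : nat -> K,
    (forall e, 0 < e -> exists N, forall i j,
       (N <= i)%N -> (N <= j)%N -> v (s i - s j) < e) ->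
    exists l, forall e, 0 < e -> exists N, forall i,
       (N <= i)%N -> v (s i - l) < e.

Record complete_nonarch (v : K -> R) : Prop := CompleteNonarch {
  complete_nonarch_abs : nonarch_abs v;
  complete_nonarch_complete : abs_complete v }.

(* The points of (Spec A)^an: the multiplicative seminorms on A that extend
   the absolute value of K. *)
Definition mult_seminorm (v : K -> R) (A : comAlgType K) : set (A -> R) :=
  [set xi | [/\ forall f, 0 <= xi f,
                forall c, xi c%:A = v c,
                forall f g, xi (f + g) <= Num.max (xi f) (xi g)
              & forall f g, xi (f * g) = xi f * xi g]].

End Valuation.

Section Cones.
Variables (R : realType) (n : nat).

Definition cone := set 'rV[R]_n.

Definition lattice_vec (u : 'rV[int]_n) : 'rV[R]_n := map_mx intr u.

Definition pairing (u w : 'rV[R]_n) : R := \sum_i u 0 i * w 0 i.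

Definition rational_polyhedral (sigma : cone) : Prop :=
  exists (m : nat) (b : 'I_m -> 'rV[int]_n),
    sigma = [set w | exists2 c : 'I_m -> R, (forall i, 0 <= c i)
                     & w = \sum_i c i *: lattice_vec (b i)].

Definition pointed (sigma : cone) : Prop :=
  forall w, sigma w -> sigma (- w) -> w = 0.

Definition face (tau sigma : cone) : Prop :=
  exists2 u, forall w, sigma w -> 0 <= pairing u w
           & tau = sigma `&` [set w | pairing u w = 0].

Record pointed_rational_fan (Delta : set cone) : Prop := PointedRationalFan {
  fan_finite : finite_set Delta;
  fan_rational : forall sigma, Delta sigma -> rational_polyhedral sigma;
  fan_pointed : forall sigma, Delta sigma -> pointed sigma;
  fan_face : forall sigma tau, Delta sigma -> face tau sigma -> Delta tau;
  fan_meet : forall sigma tau, Delta sigma -> Delta tau ->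
    face (sigma `&` tau) sigma /\ face (sigma `&` tau) tau }.

(* sigma^vee \cap M and sigma^perp \cap M *)
Definition dual_pred (sigma : cone) : {pred 'rV[int]_n} :=
  fun u => `[< forall w, sigma w -> 0 <= pairing (lattice_vec u) w >].

Definition perp_pred (sigma : cone) : {pred 'rV[int]_n} :=
  fun u => `[< forall w, sigma w -> pairing (lattice_vec u) w = 0 >].

Let pairing0 w : pairing (lattice_vec 0) w = 0.
Proof. by rewrite /pairing big1// => i _; rewrite !mxE mul0r. Qed.

Let pairingD u1 u2 w : pairing (lattice_vec (u1 + u2)) w =
  pairing (lattice_vec u1) w + pairing (lattice_vec u2) w.
Proof.
by rewrite /pairing -big_split; apply: eq_bigr => i _; rewrite !mxE intrD mulrDl.
Qed.

Let dual_addr_closed sigma : GRing.nmod_closed (dual_pred sigma).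
Proof.
split=> [|u1 u2 /asboolP h1 /asboolP h2]; apply/asboolP => w sw.
  by rewrite pairing0.
by rewrite pairingD addr_ge0 ?h1 ?h2.
Qed.

Let perp_addr_closed sigma : GRing.nmod_closed (perp_pred sigma).
Proof.
split=> [|u1 u2 /asboolP h1 /asboolP h2]; apply/asboolP => w sw.
  by rewrite pairing0.
by rewrite pairingD h1 // h2 // addr0.
Qed.

Record dual_monoid (sigma : cone) := DualMonoid {
  dual_val : 'rV[int]_n;
  dual_valP : dual_pred sigma dual_val }.

HB.instance Definition _ sigma := [isSub for @dual_val sigma].
HB.instance Definition _ sigma := [Choice of dual_monoid sigma by <:].
HB.instance Definition _ sigma :=
  GRing.SubChoice_isSubNmodule.Build _ (dual_pred sigma) (dual_monoid sigma)
    (dual_addr_closed sigma).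

Record perp_monoid (sigma : cone) := PerpMonoid {
  perp_val : 'rV[int]_n;
  perp_valP : perp_pred sigma perp_val }.

HB.instance Definition _ sigma := [isSub for @perp_val sigma].
HB.instance Definition _ sigma := [Choice of perp_monoid sigma by <:].
HB.instance Definition _ sigma :=
  GRing.SubChoice_isSubNmodule.Build _ (perp_pred sigma) (perp_monoid sigma)
    (perp_addr_closed sigma).

(* A point of the compactification is encoded by a cone sigma together with the
   monoid homomorphism sigma^vee \cap M -> R \cup {oo} with which the point of
   N_R(sigma) is identified. *)
Record KP_point := KPPoint {
  KP_cone : cone;
  KP_hom : dual_monoid KP_cone -> \bar R }.

(* The point of N_R(sigma) = N_R / <sigma> represented by w in N_R *)
Definition NR_point (sigma : cone) (w : 'rV[R]_n) : KP_point :=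
  @KPPoint sigma (fun u => if perp_pred sigma (val u)
    then (pairing (lattice_vec (val u)) w)%:E else +oo%E).

End Cones.

Section Toric.
Variables (R : realType) (n : nat).
Local Notation cone := (cone R n).
Local Notation dual_monoid := (@dual_monoid R n).
Local Notation perp_monoid := (@perp_monoid R n).

Section OverField.
Variable K : fieldType.

(* The coordinate rings of the affine chart U_sigma and of the orbit O(sigma) *)
Definition chart_ring (sigma : cone) := monoidAlg K (dual_monoid sigma).
Definition orbit_ring (sigma : cone) := monoidAlg K (perp_monoid sigma).

Definition chart_incl (sigma tau : cone) (f : chart_ring sigma) :
  chart_ring tau := malg_restr (dual_monoid tau) f.

Definition orbit_proj (sigma : cone) (f : chart_ring sigma) :
  orbit_ring sigma := malg_restr (perp_monoid sigma) f.

(* A quasi-coherent ideal sheaf on Y_Delta: an ideal on each chart, compatible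
   with localization along faces. Only the values at cones of Delta matter. *)
Record closed_subscheme (Delta : set cone)
    (X : forall sigma, set (chart_ring sigma)) : Prop := ClosedSubscheme {
  subscheme_ideal : forall sigma, Delta sigma -> is_ideal (X sigma);
  subscheme_glue : forall sigma tau, Delta sigma -> face tau sigma ->
    X tau = ideal_gen (@chart_incl sigma tau @` X sigma) }.

(* As Y_Delta is set-theoretically the disjoint union of its orbits, a point of
   Y_Delta^an is a cone together with a point of O(sigma)^an. *)
Record an_point := AnPoint {
  an_cone : cone;
  an_seminorm : orbit_ring an_cone -> R }.

Variables (v : K -> R) (Delta : set cone).
Variable X : forall sigma, set (chart_ring sigma).

Definition Xan : set an_point :=
  [set x | [/\ Delta (an_cone x), mult_seminorm v (@an_seminorm x)
             & forall f, X f -> an_seminorm (@orbit_proj (an_cone x) f) = 0]].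

Definition chi (sigma : cone) (u : dual_monoid sigma) : chart_ring sigma :=
  << 1 *g u >>.

Definition trop (x : an_point) : KP_point R n :=
  @KPPoint _ _ (an_cone x)
    (fun u => - lne (an_seminorm (orbit_proj (chi u)))%:E)%E.

Section Affinoid.
Variables (sigma : cone) (w : 'rV[R]_n).

(* X_omega, for the point omega of N_R(sigma) represented by w *)
Definition trop_fiber : set {ptws orbit_ring sigma -> R} :=
  [set xi | Xan (AnPoint xi) /\ trop (AnPoint xi) = NR_point sigma w].

(* X_omega is the spectrum of the quotient, by the ideal of X, of the algebra
   of Laurent series sum_(u in sigma^perp) a_u chi^u such that
   |a_u| exp(- <u, omega>) tends to 0. Hence the analytic functions on X_omega
   are those given by such families a. *)
Definition affinoid_series : set (perp_monoid sigma -> K) :=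
  [set a | forall e, 0 < e -> finite_set
     [set u | e <= v (a u) * expR (- pairing (lattice_vec R (val u)) w)]].

Definition series_trunc (a : perp_monoid sigma -> K)
    (J : {fset perp_monoid sigma}) : orbit_ring sigma :=
  \sum_(u <- J) << a u *g u >>.

(* |f(xi)| for the function f on X_omega with series a *)
Definition series_abs (a : perp_monoid sigma -> K)
    (xi : orbit_ring sigma -> R) : R :=
  lim ((fun J => xi (series_trunc a J)) @ totally).

(* The Berkovich topology of X_omega is that of pointwise convergence, for
   which X_omega is closed in the space of all functions. The smallest boundary
   is taken among the closed ones, as usual: over an algebraically closed field
   with nontrivial valuation, if X_omega is strictly affinoid, then every |f|
   also attains its maximum on the set of rigid points. *)
Definition is_boundary (G : set {ptws orbit_ring sigma -> R}) : Prop :=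
  [/\ closed G, G `<=` trop_fiber
    & forall a, affinoid_series a -> exists2 g, G g &
        forall xi, trop_fiber xi -> series_abs a xi <= series_abs a g].

Definition is_shilov_boundary (G : set {ptws orbit_ring sigma -> R}) : Prop :=
  is_boundary G /\ forall G', is_boundary G' -> G `<=` G'.

End Affinoid.

Definition S_Trop : set an_point :=
  [set x | Xan x /\ exists w, trop x = NR_point (an_cone x) w /\
     exists2 G, is_shilov_boundary w G & G (@an_seminorm x)].

End OverField.

Section BaseChange.
Variables (K K' : fieldType) (iota : {rmorphism K -> K'}).

Definition subscheme_ext (X : forall sigma, set (chart_ring K sigma))
    (sigma : cone) : set (chart_ring K' sigma) :=
  ideal_gen (@malg_scal K K' iota (dual_monoid sigma) @` X sigma).

Definition structural_map (x : an_point K') : an_point K :=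
  AnPoint (fun f : orbit_ring K (an_cone x) =>
    an_seminorm (malg_scal iota f : orbit_ring K' (an_cone x))).

End BaseChange.
End Toric.

(* Main.v *)
Require Import Defs.
From HB Require Import structures.
From mathcomp Require Import all_boot all_order all_algebra finmap.
From mathcomp.multinomials Require Import monalg.
From mathcomp Require Import all_classical all_reals all_analysis.
From mathcomp Require Import summability.
From mathcomp Require Import ring lra.

(* A submultiplicative ultrametric seminorm t dominates a multiplicative one that
   is large at a given F whenever the powers of F have large seminorms: among the
   seminorms below t, a minimal one coincides with its spectral seminorm and with
   its localizations, hence is multiplicative.

   Since K is complete, every finite-dimensional K-subspace of K' has
   alpha-orthogonal bases for every alpha > 1. Hence the tensor product of a point
   x of X_w with the absolute value of K' restricts to x, and its multiplicative
   minorants give points of X_w over K' above x. An alpha-orthogonal basis does not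
   depend on x; so if G is a boundary of X_w, then the maximum of |F| on X_w over
   K' is governed by the tensor seminorms at the points of G, and a compactness
   argument shows that it is attained above G. Therefore preimages of boundaries
   are boundaries, as are images.

   It remains to compare least boundaries. They exist for every nonempty compact
   set of multiplicative seminorms: a minimal boundary is contained in every
   boundary. *)

Set Implicit Arguments.
Unset Strict Implicit.
Unset Printing Implicit Defensive.

Import Order.TTheory GRing.Theory Num.Theory.
Import numFieldNormedType.Exports.

Local Open Scope classical_set_scope.
Local Open Scope ring_scope.

(** * Elementary estimates *)

(** Since K need not be spherically complete, the distance to a finite-dimensional subspace of K'
    need not be attained, and exactly orthogonal bases may fail to exist; hence the constants alpha
    > 1. They are harmless: the estimates are made for all powers of F, and a constant factor does
    not change a growth rate. The price is that the point of G found for F^m depends on m. A bound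
    for F^(mk) does imply one for F^m, so exponents divisible by every small m lead to a single
    point.

    No affinoid algebra enters before the very end: a convergent series agrees in absolute value
    with a truncation wherever the truncation exceeds the tail, so that boundaries can be tested on
    Laurent polynomials, and X_w becomes a compact set of multiplicative seminorms with fixed values
    on characters. *)

Section Geometric.
Variable R : realType.
Implicit Types c C s z e rho : R.

Lemma expr_small z e : 0 <= z < 1 -> 0 < e -> exists n, z ^+ n < e.
Proof.
move=> /andP[z0 z1] e0.
have /cvgrPdist_lt/(_ e e0) : (GRing.exp z @ \oo) --> (0 : R).
  by apply: cvg_expr; rewrite ger0_norm.
case=> N _ /(_ N (leqnn N)) /=; rewrite sub0r normrN ger0_norm ?exprn_ge0// => h.
by exists N.
Qed.

(** If s < rho, then (s / rho)^n tends to 0 and contradicts the bounds. This replaces taking n-th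
    roots. The sign of C is free, whence [|C| + 1] in the proof. *)
Lemma geometric_le c C s rho : 0 < c -> 0 <= s ->
  (forall n, c * rho ^+ n <= C * s ^+ n) -> rho <= s.
Proof.
move=> c0 s0 H; rewrite leNgt; apply/negP => srho.
have r0 : 0 < rho by apply: le_lt_trans srho.
have [n hn] : exists n, (s / rho) ^+ n < c / (`|C| + 1).
  apply: expr_small; first by rewrite divr_ge0 ?(ltW r0)// ltr_pdivrMr ?mul1r.
  by rewrite divr_gt0// ltr_wpDl.
have := H n; apply/negP; rewrite -ltNge.
have C1 : 0 < `|C| + 1 by rewrite ltr_wpDl.
have : s ^+ n * (`|C| + 1) < c * rho ^+ n.
  by move: hn; rewrite ltr_pdivlMr// expr_div_n mulrAC ltr_pdivrMr ?exprn_gt0.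
apply: le_lt_trans; rewrite mulrC ler_wpM2l ?exprn_ge0//.
by rewrite (le_trans (ler_norm _))// lerDl.
Qed.

End Geometric.

Lemma le_mul_gt1 (R : realType) (a b : R) : 0 <= b ->
  (forall c, 1 < c -> a <= c * b) -> a <= b.
Proof.
move=> b0 H; apply/ler_addgt0Pr => e e0.
have b1 : 0 < b + 1 by rewrite ltr_wpDl.
apply: le_trans (H (1 + e / (b + 1)) _) _; first by rewrite ltrDl divr_gt0.
rewrite mulrDl mul1r lerD2l mulrAC ler_pdivrMr// ler_wpM2l ?lerDl//; exact: ltW.
Qed.

Lemma le_mul_approx (R : realType) (a b c : R) : 0 <= a -> 0 <= b ->
  (forall r s, a < r -> b < s -> c <= r * s) -> c <= a * b.
Proof.
move=> a0 b0 H; apply/ler_addgt0Pr => e e0.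
have S0 : 0 < a + b + 1 by rewrite ltr_wpDl// addr_ge0.
(* As d <= 1, (a + d)(b + d) exceeds a b by at most d (a + b + 1) <= e. *)
pose d := Num.min 1 (e / (a + b + 1)).
have d1 : d <= 1 by rewrite ge_min lexx.
have dd : 0 < d by rewrite lt_min ltr01 divr_gt0.
have dE : d * (a + b + 1) <= e by rewrite -ler_pdivlMr// ge_min lexx orbT.
apply: (le_trans (H (a + d) (b + d) _ _)); rewrite ?ltrDl//; nra.
Qed.

(** * Multiplicative minorants of ring seminorms *)

Section RingSeminorm.
Variables (R : realType) (A : comNzRingType).
Implicit Types (q t : A -> R) (f g h : A) (D : A -> R -> Prop).

Record ring_seminorm q : Prop := RingSeminorm {
  rsn_ge0 : forall f, 0 <= q f;
  rsn0 : q 0 = 0;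
  rsn1 : q 1 = 1;
  rsnD : forall f g, q (f + g) <= Num.max (q f) (q g);
  rsnM : forall f g, q (f * g) <= q f * q g }.

(** The case h = 1 is the lower bound r <= q f. That bound alone would get lost on the way to a
    minimal seminorm, whereas expansion by r is inherited by spectral seminorms, localizations and
    infima of chains. *)
Definition expanded_by D q :=
  forall f r, D f r -> 0 < r /\ forall h, r * q h <= q (f * h).

Lemma rsnX q f n : ring_seminorm q -> q (f ^+ n) <= q f ^+ n.
Proof.
move=> hq; elim: n => [|n IH]; first by rewrite !expr0 rsn1.
by rewrite !exprS (le_trans (rsnM hq _ _))// ler_wpM2l ?(rsn_ge0 hq).
Qed.

(** * Spectral seminorms *)

Section Spectral.
Variable q : A -> R.
Hypothesis hq : ring_seminorm q.

(** The infimum of these rates is the limit of q(f^n)^(1/n), obtained without roots or limits. The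
    rate 0 is left out so that one can divide by s. *)
Definition growth_rates f : set R :=
  [set s | 0 < s /\ exists C, forall n, q (f ^+ n) <= C * s ^+ n].

Definition spectral f : R := inf (growth_rates f).

Let growth_gt f s : q f < s -> growth_rates f s.
Proof.
move=> qs; have s0 : 0 < s by rewrite (le_lt_trans (rsn_ge0 hq f)).
split=> //; exists 1 => n; rewrite mul1r (le_trans (rsnX _ _ hq))//.
by rewrite lerXn2r ?nnegrE ?(rsn_ge0 hq) ?ltW.
Qed.

Let growth_has_inf f : has_inf (growth_rates f).
Proof.
split; last by exists 0 => s [/ltW].
by exists (q f + 1); apply: growth_gt; rewrite ltrDl.
Qed.

Lemma spectral_le f s : growth_rates f s -> spectral f <= s.
Proof. by move=> H; apply: ge_inf => //; case: (growth_has_inf f). Qed.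

Lemma spectral_ge f r : (forall s, growth_rates f s -> r <= s) -> r <= spectral f.
Proof. by move=> H; apply: lb_le_inf => //; case: (growth_has_inf f). Qed.

Lemma spectral_lt f r : spectral f < r -> growth_rates f r.
Proof.
move=> H; have [s [s0 [C hC]] sr] := inf_lt (growth_has_inf f).1 H.
split; first exact: lt_trans sr.
exists C => n; rewrite (le_trans (hC n))// ler_wpM2l//.
  by have := hC 0; rewrite !expr0 rsn1// mulr1; apply: le_trans.
by rewrite lerXn2r ?nnegrE ?ltW// (lt_trans s0 sr).
Qed.

Lemma spectral_ge0 f : 0 <= spectral f.
Proof. by apply: spectral_ge => s [/ltW]. Qed.

Lemma spectral_le_self f : spectral f <= q f.
Proof.
by apply/ler_addgt0Pr => e e0; apply: spectral_le; apply: growth_gt; rewrite ltrDl.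
Qed.

Lemma spectral_lower f c r : 0 < c -> (forall n, c * r ^+ n <= q (f ^+ n)) ->
  r <= spectral f.
Proof.
move=> c0 H; apply: spectral_ge => s [s0 [C hC]].
by apply: (@geometric_le _ c C) => //; [exact: ltW|move=> n; exact: le_trans (hC n)].
Qed.

Lemma ring_seminorm_spectral : ring_seminorm spectral.
Proof.
have Cge0 f s C : (forall n, q (f ^+ n) <= C * s ^+ n) -> 0 <= C.
  by move=> /(_ 0); rewrite !expr0 (rsn1 hq) mulr1; apply: le_trans.
split; first exact: spectral_ge0.
- by apply/eqP; rewrite eq_le spectral_ge0 -(rsn0 hq) spectral_le_self.
- apply/eqP; rewrite eq_le -{1}(rsn1 hq) spectral_le_self/=.
  by apply: (@spectral_lower _ 1) => // n; rewrite !expr1n (rsn1 hq) mulr1.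
- move=> f g; apply/ler_addgt0Pr => e e0; set s := _ + e.
  have sM : Num.max (spectral f) (spectral g) < s by rewrite ltrDl.
  have /spectral_lt[s0 [C hC]] : spectral f < s.
    by apply: le_lt_trans sM; rewrite le_max lexx.
  have /spectral_lt[_ [C' hC']] : spectral g < s.
    by apply: le_lt_trans sM; rewrite le_max lexx orbT.
  apply: spectral_le; split => //; exists (C * C') => n; rewrite exprDn.
  have C0 := Cge0 _ _ _ hC; have C0' := Cge0 _ _ _ hC'.
  apply: (big_ind (fun u => q u <= C * C' * s ^+ n)).
  + by rewrite (rsn0 hq) mulr_ge0 ?exprn_ge0 ?(ltW s0)// mulr_ge0.
  + by move=> u w hu hw; rewrite (le_trans (rsnD hq _ _))// ge_max hu.
  move=> i _.
  (* Binomial coefficients do no harm, since an ultrametric seminorm does not grow under integer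
     multiples. *)
  have mn u m b : 0 <= b -> q u <= b -> q (u *+ m) <= b.
    move=> b0 hu; elim: m => [|m IH]; first by rewrite mulr0n (rsn0 hq).
    by rewrite mulrS (le_trans (rsnD hq _ _))// ge_max hu.
  apply: mn; first by rewrite mulr_ge0 ?exprn_ge0 ?(ltW s0)// mulr_ge0.
  rewrite (le_trans (rsnM hq _ _))//.
  rewrite (le_trans (ler_pM _ _ (hC _) (hC' _))) ?(rsn_ge0 hq)//.
  by rewrite mulrACA -exprD subnK// -ltnS ltn_ord.
- move=> f g; apply: le_mul_approx; rewrite ?spectral_ge0// => s s'.
  move=> /spectral_lt[s0 [C hC]] /spectral_lt[s0' [C' hC']].
  apply: spectral_le; split; first by rewrite mulr_gt0.
  exists (C * C') => n; rewrite !exprMn mulrACA (le_trans (rsnM hq _ _))//.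
  by rewrite ler_pM ?(rsn_ge0 hq).
Qed.

Lemma expanded_by_spectral D : expanded_by D q -> expanded_by D spectral.
Proof.
move=> HD f r /HD[r0 Hr]; split=> // h; apply: spectral_ge => s [s0 [C hC]].
(* A rate s of f h yields the rate s / r of h, because expanding n times gives r^n q(h^n) <= q((f
   h)^n). *)
rewrite mulrC -ler_pdivlMr//; apply: spectral_le; split; first by rewrite divr_gt0.
exists C => n; rewrite expr_div_n mulrA ler_pdivlMr ?exprn_gt0//.
apply: le_trans (hC n); rewrite exprMn mulrC.
elim: n (h ^+ n) => [|n IH] u; first by rewrite !expr0 !mul1r.
rewrite !exprS -!mulrA (le_trans _ (Hr _))// ler_wpM2l ?IH//; exact: ltW.
Qed.

(** A rate s of f^N yields the rate s^(1/N) of f: divide the exponent by N with remainder, and let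
    the constant absorb the finitely many remainders. *)
Lemma spectralX f n : spectral f ^+ n <= spectral (f ^+ n).
Proof.
case: n => [|n]; first by rewrite !expr0 (rsn1 ring_seminorm_spectral).
apply: spectral_ge => s [s0 [C hC]]; set N := n.+1 in hC *.
have N0 : N%:R != 0 :> R by rewrite pnatr_eq0.
pose r := s `^ (N%:R^-1).
have rN : r ^+ N = s by rewrite -powR_mulrn ?powR_ge0// -powRrM mulVf// powRr1 // ltW.
rewrite -rN lerXn2r ?nnegrE ?spectral_ge0 ?powR_ge0//.
have r0 : 0 < r by rewrite powR_gt0.
apply: spectral_le; split => //.
exists (C * \sum_(i < N) q (f ^+ i) / r ^+ i) => m.
have -> : f ^+ m = (f ^+ N) ^+ (m %/ N) * f ^+ (m %% N).
  by rewrite -exprM -exprD mulnC -divn_eq.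
have -> : r ^+ m = s ^+ (m %/ N) * r ^+ (m %% N).
  by rewrite -rN -exprM -exprD mulnC -divn_eq.
rewrite (le_trans (rsnM hq _ _))// mulrACA ler_pM ?(rsn_ge0 hq) ?hC//.
rewrite -ler_pdivrMr ?exprn_gt0//.
have mN : (m %% N < N)%N by rewrite ltn_mod.
rewrite (bigD1 (Ordinal mN))//= lerDl sumr_ge0// => i _.
by rewrite divr_ge0 ?(rsn_ge0 hq) ?exprn_ge0// ltW.
Qed.

End Spectral.

(** * Localization of a seminorm at an element *)

Section Localize.
Variables (q : A -> R) (g : A).
Hypotheses (hq : ring_seminorm q) (g0 : 0 < q g).
Hypothesis gX : forall n, q g ^+ n <= q (g ^+ n).

Let seq_loc h := range (fun n => q (h * g ^+ n) / q g ^+ n).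

(** By submultiplicativity the quotients are nonincreasing in n, so this infimum is a limit. The
    hypothesis [gX] keeps the value at 1 equal to 1. *)
Definition localized h : R := inf (seq_loc h).

Let seq_loc_inf h : has_inf (seq_loc h).
Proof.
split; first by eexists; exists 0.
by exists 0 => _ [n _ <-]; rewrite divr_ge0 ?exprn_ge0 ?(rsn_ge0 hq) ?ltW.
Qed.

Lemma localized_le h n : localized h <= q (h * g ^+ n) / q g ^+ n.
Proof. by apply: ge_inf; [case: (seq_loc_inf h) | exists n]. Qed.

Lemma localized_ge h r :
  (forall n, r <= q (h * g ^+ n) / q g ^+ n) -> r <= localized h.
Proof. by move=> H; apply: lb_le_inf; [case: (seq_loc_inf h) | move=> _ [n _ <-]]. Qed.

Lemma localized_lt h r : localized h < r ->
  exists N, forall n, (N <= n)%N -> q (h * g ^+ n) / q g ^+ n < r.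
Proof.
move=> H; have [_ [N _ <-] sr] := inf_lt (seq_loc_inf h).1 H.
exists N => n Nn; apply: le_lt_trans sr.
rewrite -(subnKC Nn) !exprD mulrA.
rewrite ler_pdivrMr ?mulr_gt0 ?exprn_gt0// mulrA divfK ?gt_eqF ?exprn_gt0//.
rewrite (le_trans (rsnM hq _ _))// ler_wpM2l ?(rsn_ge0 hq)//; exact: rsnX.
Qed.

Lemma localized_ge0 h : 0 <= localized h.
Proof. by apply: localized_ge => n; rewrite divr_ge0 ?exprn_ge0 ?(rsn_ge0 hq) ?ltW. Qed.

Lemma localized_le_self h : localized h <= q h.
Proof. by have := localized_le h 0; rewrite !expr0 mulr1 divr1. Qed.

Lemma ring_seminorm_localized : ring_seminorm localized.
Proof.
split; first exact: localized_ge0.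
- by apply/eqP; rewrite eq_le localized_ge0 -(rsn0 hq) localized_le_self.
- apply/eqP; rewrite eq_le -{1}(rsn1 hq) localized_le_self/=.
  by apply: localized_ge => n; rewrite mul1r ler_pdivlMr ?exprn_gt0// mul1r.
- move=> f h; apply/ler_addgt0Pr => e e0; set s := _ + e.
  have sM : Num.max (localized f) (localized h) < s by rewrite ltrDl.
  have /localized_lt[N hN] : localized f < s.
    by apply: le_lt_trans sM; rewrite le_max lexx.
  have /localized_lt[N' hN'] : localized h < s.
    by apply: le_lt_trans sM; rewrite le_max lexx orbT.
  apply: le_trans (localized_le _ (maxn N N')) _.
  rewrite ler_pdivrMr ?exprn_gt0// mulrDl (le_trans (rsnD hq _ _))//.
  rewrite ge_max -!ler_pdivrMr ?exprn_gt0//.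
  by rewrite !ltW// ?hN ?hN'// ?leq_maxl ?leq_maxr.
- move=> f h; apply: le_mul_approx; rewrite ?localized_ge0// => r r'.
  move=> /localized_lt[N hN] /localized_lt[N' hN'].
  apply: le_trans (localized_le _ (maxn N N' + maxn N N')) _.
  rewrite exprD mulrACA exprD.
  rewrite ler_pdivrMr ?mulr_gt0 ?exprn_gt0// (le_trans (rsnM hq _ _))// mulrACA.
  by rewrite ler_pM ?(rsn_ge0 hq)// -!ler_pdivrMr ?exprn_gt0// ltW// ?hN ?hN' ?leq_maxl ?leq_maxr.
Qed.

Lemma expanded_by_localized D : expanded_by D q -> expanded_by D localized.
Proof.
move=> HD f r /HD[r0 Hr]; split=> // h; apply: localized_ge => n.
rewrite ler_pdivlMr ?exprn_gt0// -mulrA (le_trans _ (Hr _))//.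
by rewrite -mulrA ler_wpM2l ?(ltW r0)// -ler_pdivlMr ?exprn_gt0// localized_le.
Qed.

(** Multiplying h by g merely shifts the sequence of quotients by one term and scales it by q g. *)
Lemma localized_mul h : q g * localized h <= localized (g * h).
Proof.
apply: localized_ge => n; rewrite ler_pdivlMr ?exprn_gt0//.
rewrite mulrAC mulrC -exprS -ler_pdivlMr ?exprn_gt0//.
by rewrite (mulrC g) -mulrA -exprS localized_le.
Qed.

End Localize.

(** * Minimal seminorms are multiplicative *)

Definition multiplicative_seminorm q := ring_seminorm q /\ {morph q : f g / f * g}.

Lemma exists_minimal_seminorm D t : ring_seminorm t -> expanded_by D t ->
  exists q, [/\ ring_seminorm q, expanded_by D q, forall f, q f <= t f &
    forall q', ring_seminorm q' -> expanded_by D q' -> (forall f, q' f <= q f) ->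
      q' = q].
Proof.
move=> ht Dt.
pose P q := [/\ ring_seminorm q, expanded_by D q & forall f, q f <= t f].
(* The order is reversed: maximal elements for [le] are minimal seminorms. *)
pose T := {q | P q}; pose le (p q : T) := `[< forall f, sval q f <= sval p f >].
have Pt : P t by [].
have [||F Ftot|[q [hq Dq qt]] qmax] := @ZL_preorder T (exist _ t Pt) le.
- by move=> p; apply/asboolP.
- by move=> p q r /asboolP pq /asboolP qr; apply/asboolP => f; apply: le_trans (pq f).
(* A pointwise infimum over the empty chain would be meaningless; t bounds that chain instead. *)
- have [->|/set0P[q0 Fq0]] := eqVneq F set0; first by exists (exist _ t Pt).
  pose S f := [set sval p f | p in F].
  have S_inf f : has_inf (S f).
    split; first by exists (sval q0 f); exists q0.
    by exists 0 => _ [p _ <-]; case: (svalP p) => hp _ _; exact: (rsn_ge0 hp).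
  pose m f := inf (S f).
  have m_le p f : F p -> m f <= sval p f.
    by move=> Fp; apply: ge_inf; [case: (S_inf f)|exists p].
  have m_ge f r : (forall p, F p -> r <= sval p f) -> r <= m f.
    by move=> H; apply: lb_le_inf; [case: (S_inf f)|move=> _ [p Fp <-]; exact: H].
  have m_lt f r : m f < r -> exists2 p, F p & sval p f < r.
    by move=> /(inf_lt (S_inf f).1)[_ [p Fp <-]]; exists p.
  (* In a chain one member realizes both strict bounds, as needed for the ultrametric inequality and
     submultiplicativity of m. *)
  have m_lt2 f g r s : m f < r -> m g < s ->
      exists p, [/\ F p, sval p f < r & sval p g < s].
    move=> /m_lt[p Fp pf] /m_lt[p' Fp' pg].
    have [/asboolP H|/asboolP H] := Ftot _ _ Fp Fp'.
      by exists p'; split => //; apply: le_lt_trans pf.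
    by exists p; split => //; apply: le_lt_trans pg.
  have m0 f : 0 <= m f by apply: m_ge => p _; case: (svalP p) => hp _ _; exact: (rsn_ge0 hp).
  have Pm : P m.
    split; first split => //.
    + apply/eqP; rewrite eq_le m0 andbT (le_trans (m_le _ _ Fq0))//.
      by case: (svalP q0) => hp _ _; rewrite (rsn0 hp).
    + apply/eqP; rewrite eq_le (le_trans (m_le _ _ Fq0)); last first.
        by case: (svalP q0) => hp _ _; rewrite (rsn1 hp).
      by apply: m_ge => p _; case: (svalP p) => hp _ _; rewrite (rsn1 hp).
    + move=> f g; apply/ler_addgt0Pr => e e0; set s := _ + e.
      have sM : Num.max (m f) (m g) < s by rewrite ltrDl.
      have [||p [Fp pf pg]] := @m_lt2 f g s s.
      * by apply: le_lt_trans sM; rewrite le_max lexx.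
      * by apply: le_lt_trans sM; rewrite le_max lexx orbT.
      apply: le_trans (m_le _ _ Fp) _; case: (svalP p) => hp _ _.
      by rewrite (le_trans (rsnD hp _ _))// ge_max !ltW.
    + move=> f g; apply: le_mul_approx => // r r' mf mg.
      have [p [Fp pf pg]] := m_lt2 _ _ _ _ mf mg.
      apply: le_trans (m_le _ _ Fp) _; case: (svalP p) => hp _ _.
      by rewrite (le_trans (rsnM hp _ _))// ler_pM ?(rsn_ge0 hp)// ltW.
    + move=> f r Dfr; have r0 := (Dt _ _ Dfr).1; split => // h.
      apply: m_ge => p Fp; apply: (@le_trans _ _ (r * sval p h)).
        by rewrite ler_wpM2l ?m_le// ltW.
      by case: (svalP p) => _ Dp _; exact: (Dp _ _ Dfr).2.
    + move=> f; apply: le_trans (m_le _ _ Fq0) _.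
      by case: (svalP q0) => _ _.
  by exists (exist _ m Pm) => p Fp; apply/asboolP => f; exact: m_le.
exists q; split => // q' hq' Dq' q'q.
have Pq' : P q' by split => // f; exact: le_trans (qt f).
have /asboolP H : le (exist P q (And3 hq Dq qt)) (exist P q' Pq') by apply/asboolP.
have /asboolP := qmax _ (introT (asboolP _) H) => /= H'.
by apply/funext => f; apply/eqP; rewrite eq_le q'q H'.
Qed.

Theorem exists_multiplicative_seminorm D t : ring_seminorm t -> expanded_by D t ->
  exists q, [/\ multiplicative_seminorm q, forall f, q f <= t f &
    forall f r, D f r -> r <= q f].
Proof.
move=> ht Dt; have [q [hq Dq qt qmin]] := exists_minimal_seminorm ht Dt.
exists q; split=> //; last first.
  by move=> f r /Dq[_ /(_ 1)]; rewrite (rsn1 hq) !mulr1.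
split=> // f g; apply/eqP; rewrite eq_le (rsnM hq).
have [f0|] := ltP 0 (q f); last first.
  by move=> f0; apply: le_trans (rsn_ge0 hq _); rewrite mulr_le0_ge0 ?(rsn_ge0 hq).
have qsp : spectral q = q.
  apply: qmin; [exact: ring_seminorm_spectral|exact: expanded_by_spectral|].
  exact: spectral_le_self.
have fX n : q f ^+ n <= q (f ^+ n) by rewrite -qsp spectralX.
have qloc : localized q f = q.
  apply: qmin; [exact: ring_seminorm_localized|exact: expanded_by_localized|].
  exact: localized_le_self.
by have := localized_mul hq f0 g; rewrite qloc.
Qed.

(** Localizing the spectral seminorm at F makes multiplication by F expand by [spectral t F]. The
    pair of F and this number can then be added to D, which forces the multiplicative minorant to be
    large at F. *)
Corollary exists_large_multiplicative_seminorm D t F c rho :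
  ring_seminorm t -> expanded_by D t -> 0 < c -> 0 < rho ->
  (forall n, c * rho ^+ n <= t (F ^+ n)) ->
  exists q, [/\ multiplicative_seminorm q, forall f, q f <= t f,
    forall f r, D f r -> r <= q f & rho <= q F].
Proof.
move=> ht Dt c0 rho0 H.
have hs := ring_seminorm_spectral ht.
have rhos : rho <= spectral t F by exact: spectral_lower H.
have F0 : 0 < spectral t F by exact: lt_le_trans rhos.
have FX n : spectral t F ^+ n <= spectral t (F ^+ n) by exact: spectralX.
have hl := ring_seminorm_localized hs F0 FX.
pose D' f r := D f r \/ (f = F /\ r = spectral t F).
have D'l : expanded_by D' (localized (spectral t) F).
  move=> f r [/(expanded_by_localized hs F0 (expanded_by_spectral ht Dt))//|[-> ->]].
  by split => // h; exact: localized_mul.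
have [q [qm qt qD]] := exists_multiplicative_seminorm hl D'l.
exists q; split => //.
- move=> f; apply: le_trans (qt f) _; apply: le_trans (localized_le_self _ _ _) _ => //.
  exact: spectral_le_self.
- by move=> f r Dfr; apply: qD; left.
- by apply: le_trans rhos _; apply: qD; right.
Qed.

End RingSeminorm.

(** * Non-Archimedean absolute values and monoid algebras *)

Section Nonarch.
Variables (R : realType) (K : fieldType) (v : K -> R).
Hypothesis hv : nonarch_abs v.

Lemma nonarch_abs0 : v 0 = 0.
Proof. exact/(nonarch_abs_eq0 hv). Qed.

Lemma nonarch_abs_gt0 x : x != 0 -> 0 < v x.
Proof.
move=> x0; rewrite lt_neqAle (nonarch_abs_ge0 hv) andbT eq_sym.
by apply: contra x0 => /eqP/(nonarch_abs_eq0 hv)/eqP.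
Qed.

Lemma nonarch_abs1 : v 1 = 1.
Proof.
have v1 : v 1 != 0 by rewrite gt_eqF// nonarch_abs_gt0 ?oner_eq0.
by apply: (mulfI v1); rewrite -(nonarch_absM hv) !mulr1.
Qed.

Lemma nonarch_absN x : v (- x) = v x.
Proof.
have : (v (-1) - 1) * (v (-1) + 1) = 0.
  rewrite -subr_sqr expr2 -(nonarch_absM hv) mulrN1 opprK nonarch_abs1.
  by rewrite expr1n subrr.
have v1_neq0 : v (-1) + 1 != 0 by rewrite gt_eqF// ltr_wpDl// (nonarch_abs_ge0 hv).
move=> /eqP; rewrite mulf_eq0 subr_eq0 (negbTE v1_neq0) orbF => /eqP v1.
by rewrite -mulN1r (nonarch_absM hv) v1 mul1r.
Qed.

Lemma nonarch_absB x y : v (x - y) <= Num.max (v x) (v y).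
Proof. by rewrite -(nonarch_absN y); exact: nonarch_absD. Qed.

Lemma nonarch_abs_sum_le I (r : seq I) (P : pred I) (F : I -> K) e : 0 <= e ->
  (forall i, P i -> v (F i) <= e) -> v (\sum_(i <- r | P i) F i) <= e.
Proof.
move=> e0 H; apply: (big_ind (fun z => v z <= e)) => //; first by rewrite nonarch_abs0.
by move=> x y hx hy; rewrite (le_trans (nonarch_absD hv _ _))// ge_max hx.
Qed.

End Nonarch.

Section MonoidAlgebra.
Variables (K : fieldType) (P : nmodType).
Local Notation A := (monoidAlg K P).
Implicit Types (f g : A) (u w : P).

Lemma mcoeffA u : {morph (fun f : A => f@_u) : f g / f + g}.
Proof. exact: mcoeffD. Qed.

Lemma mcoeffA_sum u I (r : seq I) (F : I -> A) :
  (\sum_(i <- r) F i)@_u = \sum_(i <- r) (F i)@_u.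
Proof. exact: (big_morph (fun f : A => f@_u) (mcoeffA u) (mcoeff0 u)). Qed.

Lemma mcoeffAZ u c f : (c *: f)@_u = c * f@_u.
Proof. exact: mcoeffZ. Qed.

Lemma malg_sumE f : f = \sum_(u <- msupp f) (<< f@_u *g u >> : A).
Proof. exact: monalgE. Qed.

Lemma malg_mulUU a b u w :
  (<< a *g u >> : A) * (<< b *g w >> : A) = (<< a * b *g u + w >> : A).
Proof.
have [->|a0] := eqVneq a 0; first by rewrite monalgU0 mul0r mul0r monalgU0.
have [->|b0] := eqVneq b 0; first by rewrite monalgU0 mulr0 mulr0 monalgU0.
rewrite [LHS]/(malg_mul _ _) /malg_mul !msuppU (negbTE a0) (negbTE b0).
by rewrite !big_seq_fset1 !mcoeffUU.
Qed.

Lemma malg_scaleU c a u : c *: (<< a *g u >> : A) = << c * a *g u >>.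
Proof. by apply/malgP => w; rewrite mcoeffAZ !mcoeffU mulrnAr. Qed.

(** By additivity it suffices to check products of monomials. The rule for monomials is a
    hypothesis, so that the lemma serves both extension of scalars and projection to an orbit. *)
Lemma malg_morphM (B : nzRingType) (phi : A -> B) :
  phi 0 = 0 -> {morph phi : f g / f + g} ->
  (forall a b u w, phi ((<< a *g u >> : A) * (<< b *g w >> : A)) =
                   phi << a *g u >> * phi << b *g w >>) ->
  {morph phi : f g / f * g}.
Proof.
move=> phi0 phiD phiM f g.
have phi_sum (I : Type) (r : seq I) (F : I -> A) :
    phi (\sum_(i <- r) F i) = \sum_(i <- r) phi (F i).
  exact: (big_morph phi phiD phi0).
rewrite [f]malg_sumE [g]malg_sumE mulr_suml !phi_sum mulr_suml.
apply: eq_bigr => u _; rewrite mulr_sumr !phi_sum mulr_sumr.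
by apply: eq_bigr => w _; rewrite phiM.
Qed.

End MonoidAlgebra.

(** * Extension of scalars of monoid algebras *)

Section Scal.
Variables (K K' : fieldType) (iota : {rmorphism K -> K'}) (P : nmodType).
Local Notation A := (monoidAlg K P).
Local Notation A' := (monoidAlg K' P).
Local Notation S := (@malg_scal K K' iota P).
Implicit Types (f g : A) (u w : P).

Lemma mcoeff_scal f u : (S f)@_u = iota f@_u.
Proof.
rewrite mcoeffA_sum [in RHS](malg_sumE f) mcoeffA_sum rmorph_sum.
by apply: eq_bigr => w _; rewrite !mcoeffU rmorphMn.
Qed.

Lemma malg_scalU c u : S << c *g u >> = << iota c *g u >>.
Proof. by apply/malgP => w; rewrite mcoeff_scal !mcoeffU rmorphMn. Qed.

Lemma malg_scal0 : S 0 = 0.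
Proof. by apply/malgP => w; rewrite mcoeff_scal !mcoeff0 rmorph0. Qed.

Lemma malg_scalD : {morph S : f g / f + g}.
Proof. by move=> f g; apply/malgP => w; rewrite !(mcoeff_scal, mcoeffA) rmorphD. Qed.

Lemma malg_scalM : {morph S : f g / f * g}.
Proof.
apply: malg_morphM malg_scal0 malg_scalD _ => a b u w.
by rewrite malg_mulUU !malg_scalU malg_mulUU rmorphM.
Qed.

Lemma malg_scalZ c f : S (c *: f) = iota c *: S f.
Proof. by apply/malgP => w; rewrite !(mcoeff_scal, mcoeffAZ) rmorphM. Qed.

Lemma malg_scal1 : S 1 = 1.
Proof. by rewrite [LHS]malg_scalU rmorph1. Qed.

Lemma malg_scal_alg c : S c%:A = (iota c)%:A.
Proof. by rewrite malg_scalZ malg_scal1. Qed.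

End Scal.

(** * Orthogonal families over a complete field *)

Section Orthogonal.
Variables (R : realType) (K K' : fieldType) (v : K -> R) (v' : K' -> R).
Hypotheses (hv : complete_nonarch v) (hv' : nonarch_abs v').
Variable iota : {rmorphism K -> K'}.
Hypothesis hiota : forall a, v' (iota a) = v a.
Implicit Types (e : seq K') (c d : nat -> K) (alpha : R).

Let hvn := complete_nonarch_abs hv.

(** Coefficients are functions on all of nat, whose values beyond the family are ignored; the type
    thus stays the same when the family is extended. *)
Definition comb e c : K' := \sum_(i < size e) iota (c i) * e`_i.

(** For alpha = 1 this is orthogonality in the usual non-Archimedean sense. In every case it implies
    linear independence over K. *)
Record orthogonal alpha e : Prop := Orthogonal {
  orthogonal_neq0 : forall i, (i < size e)%N -> e`_i != 0;
  orthogonal_le : forall c i, (i < size e)%N ->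
    v (c i) * v' e`_i <= alpha * v' (comb e c) }.

Lemma combB e c d : comb e (fun i => c i - d i) = comb e c - comb e d.
Proof. by rewrite /comb -sumrB; apply: eq_bigr => i _; rewrite rmorphB mulrBl. Qed.

Lemma combZ e a c : comb e (fun i => a * c i) = iota a * comb e c.
Proof. by rewrite /comb mulr_sumr; apply: eq_bigr => i _; rewrite rmorphM mulrA. Qed.

Lemma comb_rcons e x c : comb (rcons e x) c = comb e c + iota (c (size e)) * x.
Proof.
rewrite /comb size_rcons big_ord_recr/= nth_rcons ltnn eqxx; congr (_ + _).
by apply: eq_bigr => i _; rewrite nth_rcons ltn_ord.
Qed.

Lemma eq_comb e c d : (forall i, (i < size e)%N -> c i = d i) -> comb e c = comb e d.
Proof. by move=> H; apply: eq_bigr => i _; rewrite H. Qed.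

Lemma comb_cat e1 e2 c : exists d, comb e1 c = comb (e1 ++ e2) d.
Proof.
exists (fun i => if (i < size e1)%N then c i else 0).
rewrite /comb size_cat big_split_ord/= [X in _ = _ + X]big1 ?addr0; last first.
  by move=> i _; rewrite ltnNge leq_addr rmorph0 mul0r.
by apply: eq_bigr => i _; rewrite nth_cat ltn_ord.
Qed.

Lemma orthogonalW alpha beta e : alpha <= beta -> orthogonal alpha e -> orthogonal beta e.
Proof.
move=> ab [e0 eo]; split => // c i ie; apply: le_trans (eo c i ie) _.
by rewrite ler_wpM2r ?(nonarch_abs_ge0 hv').
Qed.

(* This is where the completeness of K is needed. *)
Lemma orthogonal_dist_gt0 alpha e x : 0 <= alpha -> orthogonal alpha e ->
  (forall c, x <> comb e c) -> exists2 d, 0 < d & forall c, d <= v' (x - comb e c).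
Proof.
move=> a0 [e0 eo] xe; apply: contrapT => H.
have approx n : exists c, v' (x - comb e c) < n.+1%:R^-1.
  apply: contrapT => Hn; apply: H; exists n.+1%:R^-1 => [|c].
    by rewrite invr_gt0.
  by rewrite leNgt; apply/negP => xc; apply: Hn; exists c.
have [s hs] := choice approx.
have small (eps : R) : 0 < eps -> exists N, forall n, (N <= n)%N -> n.+1%:R^-1 < eps.
  move=> eps0; have [N _ HN] := near_infty_natSinv_lt (PosNum eps0).
  by exists N => n /HN.
have lim_ex i : exists l, (i < size e)%N -> forall eps, 0 < eps ->
    exists N, forall n, (N <= n)%N -> v (s n i - l) < eps.
  have [ie|ie] := boolP (i < size e)%N; last by exists 0.
  have [|l hl] := @complete_nonarch_complete _ _ _ hv (fun n => s n i); last by exists l.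
  move=> eps eps0; have ei0 := nonarch_abs_gt0 hv' (e0 i ie).
  have a1 : 0 < alpha + 1 by rewrite ltr_wpDl.
  have [|N HN] := small (eps * v' e`_i / (alpha + 1)); first by rewrite divr_gt0 ?mulr_gt0.
  (* Orthogonality turns the Cauchy property of the combinations into that of each coefficient. *)
  exists N => n m Nn Nm; rewrite -(ltr_pM2r ei0).
  apply: le_lt_trans (eo (fun i => s n i - s m i) i ie) _; rewrite combB.
  have -> : comb e (s n) - comb e (s m) = (x - comb e (s m)) - (x - comb e (s n)) by ring.
  apply: (@le_lt_trans _ _ ((alpha + 1) * v' (x - comb e (s m) - (x - comb e (s n))))).
    by rewrite ler_wpM2r ?(nonarch_abs_ge0 hv')// lerDl.
  rewrite mulrC -ltr_pdivlMr//; apply: le_lt_trans (nonarch_absB hv' _ _) _.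
  by rewrite gt_max !(lt_trans (hs _)) ?HN.
have [l hl] := choice lim_ex.
apply: (xe l); apply/eqP; rewrite -subr_eq0; apply/eqP/(nonarch_abs_eq0 hv').
apply/eqP; rewrite eq_le (nonarch_abs_ge0 hv') andbT; apply/ler_addgt0Pr => eps eps0.
rewrite add0r.
have H' (i : 'I_(size e)) : \forall n \near \oo, v (s n i - l i) * v' e`_i <= eps.
  have ei0 := nonarch_abs_gt0 hv' (e0 i (ltn_ord i)).
  have [|N HN] := hl i (ltn_ord i) (eps / v' e`_i); first by rewrite divr_gt0.
  by exists N => // n /= /HN /ltW; rewrite ler_pdivlMr.
have [N _ HN] : \forall n \near \oo, forall i : 'I_(size e),
    v (s n i - l i) * v' e`_i <= eps by exact: filter_forall.
have [N' HN'] := small eps eps0.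
pose n := maxn N N'.
have -> : x - comb e l = (x - comb e (s n)) + (comb e (s n) - comb e l) by ring.
rewrite (le_trans (nonarch_absD hv' _ _))// ge_max; apply/andP; split.
  by apply/ltW/(lt_trans (hs n))/HN'; rewrite leq_maxr.
rewrite -combB; apply: (nonarch_abs_sum_le hv'); first exact: ltW.
by move=> i _; rewrite (nonarch_absM hv') hiota; apply: HN; rewrite /= leq_maxl.
Qed.

(** The appended vector is y = x - comb e c with v' y < (beta / alpha) d, where d > 0 is the
    distance from x to the span of e. Separating a multiple of y from the span costs a factor beta /
    alpha, and separating the terms within the span costs alpha. *)
Lemma orthogonal_extend1 alpha beta e x : 1 <= alpha -> alpha < beta ->
  orthogonal alpha e -> exists e', orthogonal beta (e ++ e') /\
    exists c, x = comb (e ++ e') c.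
Proof.
move=> a1 ab eo; have a0 : 0 < alpha by apply: lt_le_trans a1.
have [[c xc]|xe] := pselect (exists c, x = comb e c).
  by exists [::]; rewrite cats0; split; [exact: orthogonalW (ltW ab) eo|exists c].
have {}xe c : x <> comb e c by move=> xc; apply: xe; exists c.
have [d0 d00 hd0] := orthogonal_dist_gt0 (ltW a0) eo xe.
pose D := range (fun c => v' (x - comb e c)).
have D_inf : has_inf D.
  by split; [eexists; exists (fun=> 0)|exists d0 => _ [c _ <-]].
pose d := inf D.
have dle c : d <= v' (x - comb e c) by apply: ge_inf; [case: D_inf|exists c].
have d_gt0 : 0 < d.
  by apply: lt_le_trans d00 _; apply: lb_le_inf; [case: D_inf|move=> _ [c _ <-]].
pose gam := beta / alpha.
have gam1 : 1 < gam by rewrite ltr_pdivlMr// mul1r.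
have gam0 : 0 < gam by apply: lt_trans gam1.
have [_ [c _ <-] hc] : exists2 r, D r & r < gam * d.
  by apply: inf_lt; [case: D_inf|rewrite ltr_pMl].
pose y := x - comb e c.
have y0 : y != 0 by rewrite subr_eq0; apply/eqP.
(* For a nonzero, a factors out and leaves the difference of x and a combination, whose value is at
   least d. *)
have old b a : gam * v' (comb e b + iota a * y) >= v' (iota a * y).
  rewrite (nonarch_absM hv') hiota.
  have [->|a_neq0] := eqVneq a 0.
    by rewrite nonarch_abs0// mul0r mulr_ge0 ?(nonarch_abs_ge0 hv') ?ltW.
  have va : 0 < v a by exact: nonarch_abs_gt0.
  have -> : comb e b + iota a * y =
      iota a * (x - comb e (fun i => c i - a^-1 * b i)).
    rewrite combB combZ /y fmorphV; field; by rewrite fmorph_eq0.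
  rewrite (nonarch_absM hv') hiota mulrCA ler_wpM2l ?(ltW va)//.
  by rewrite (le_trans (ltW hc))// ler_wpM2l ?dle// ltW.
have new b a : v' (comb e b) <= gam * v' (comb e b + iota a * y).
  have {1}-> : comb e b = (comb e b + iota a * y) - iota a * y by ring.
  rewrite (le_trans (nonarch_absB hv' _ _))// ge_max old andbT.
  by rewrite ler_peMl ?(nonarch_abs_ge0 hv')// ltW.
exists [:: y]; rewrite cats1; split.
  case: eo => e0 eo; split=> [i|b i].
    rewrite size_rcons ltnS leq_eqVlt nth_rcons => /orP[/eqP->|ie].
      by rewrite ltnn eqxx.
    by rewrite ie e0.
  rewrite size_rcons ltnS leq_eqVlt nth_rcons comb_rcons => /orP[/eqP->|ie].
    rewrite ltnn eqxx -hiota -(nonarch_absM hv') (le_trans (old b _))//.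
    rewrite ler_wpM2r ?(nonarch_abs_ge0 hv')// ler_pdivrMr//.
    by rewrite ler_peMr// ltW// (lt_trans a0).
  rewrite ie (le_trans (eo b i ie))// mulrC -ler_pdivlMr// mulrAC; exact: new.
exists (fun i => if (i < size e)%N then c i else 1).
rewrite comb_rcons ltnn rmorph1 mul1r.
rewrite (@eq_comb e _ c) ?/y; first by ring.
by move=> i ->.
Qed.

(** Each new vector needs a strictly larger constant, so a midpoint is used at every step. The
    family e remains a prefix, which permits comparison with a presentation already written in terms
    of e. *)
Lemma orthogonal_extend alpha beta e (s : seq K') : 1 <= alpha -> alpha < beta ->
  orthogonal alpha e -> exists e', orthogonal beta (e ++ e') /\
    forall x, x \in s -> exists c, x = comb (e ++ e') c.
Proof.
elim: s alpha e => [|x s IH] alpha e a1 ab eo.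
  by exists [::]; rewrite cats0; split => //; exact: orthogonalW (ltW ab) eo.
pose gam := (alpha + beta) / 2.
have ag : alpha < gam by rewrite /gam; lra.
have gb : gam < beta by rewrite /gam; lra.
have [e1 [e1o [c xc]]] := orthogonal_extend1 x a1 ag eo.
have [|e2 [e2o hs]] := IH gam (e ++ e1) _ gb e1o.
  by apply: le_trans a1 (ltW ag).
exists (e1 ++ e2); rewrite catA; split => // z; rewrite inE => /orP[/eqP->|/hs//].
by rewrite xc; exact: comb_cat.
Qed.

End Orthogonal.

(** * Tensor seminorms *)

Section MultSeminorm.
Variables (R : realType) (L : fieldType) (w : L -> R) (B : comAlgType L) (y : B -> R).
Implicit Types f g : B.
Hypotheses (hw : nonarch_abs w) (hy : mult_seminorm w y).

Lemma mult_seminorm_ge0 f : 0 <= y f. Proof. by case: hy. Qed.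

Lemma mult_seminormD f g : y (f + g) <= Num.max (y f) (y g). Proof. by case: hy. Qed.

Lemma mult_seminormM f g : y (f * g) = y f * y g. Proof. by case: hy. Qed.

Lemma mult_seminormZ c f : y (c *: f) = w c * y f.
Proof. by case: hy => _ ya _ yM; rewrite -mulr_algl yM ya. Qed.

Lemma mult_seminorm1 : y 1 = 1.
Proof. by case: hy => _ ya _ _; rewrite -(scale1r 1) ya nonarch_abs1. Qed.

Lemma mult_seminorm0 : y 0 = 0.
Proof. by rewrite -(scale0r 1) mult_seminormZ nonarch_abs0// mul0r. Qed.

Lemma mult_seminormN f : y (- f) = y f.
Proof. by rewrite -scaleN1r mult_seminormZ nonarch_absN// nonarch_abs1// mul1r. Qed.

Lemma mult_seminormX f n : y (f ^+ n) = y f ^+ n.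
Proof.
by elim: n => [|n IH]; rewrite ?expr0 ?mult_seminorm1// !exprS mult_seminormM IH.
Qed.

Lemma mult_seminorm_sum_le I (r : seq I) (Q : pred I) (F : I -> B) e : 0 <= e ->
  (forall i, Q i -> y (F i) <= e) -> y (\sum_(i <- r | Q i) F i) <= e.
Proof.
move=> e0 H; apply: (big_ind (fun z => y z <= e)) => //; first by rewrite mult_seminorm0.
by move=> f g hf hg; rewrite (le_trans (mult_seminormD _ _))// ge_max hf.
Qed.

End MultSeminorm.

Section Tensor.
Variables (R : realType) (K K' : fieldType) (v : K -> R) (v' : K' -> R).
Hypotheses (hv : complete_nonarch v) (hv' : nonarch_abs v').
Variable iota : {rmorphism K -> K'}.
Hypothesis hiota : forall a, v' (iota a) = v a.
Variable P : nmodType.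
Local Notation A := (monoidAlg K P).
Local Notation A' := (monoidAlg K' P).
Local Notation S := (@malg_scal K K' iota P).
Implicit Types (x : A -> R) (f g : A) (F G : A') (s : seq (K' * A)).

Let hvn := complete_nonarch_abs hv.

Definition presentation s : A' := \sum_(p <- s) p.1 *: S p.2.

(** Upper bounds take the place of the maximum over s; the condition 0 <= C accounts for the empty
    presentation. *)
Definition presentation_bounds x F : set R :=
  [set C | 0 <= C /\ exists2 s, F = presentation s &
     forall p, p \in s -> v' p.1 * x p.2 <= C].

(** Under the identification of A' with the tensor product of K' and A over K, this is the
    ultrametric projective tensor seminorm of v' and x. *)
Definition tensor_seminorm x F : R := inf (presentation_bounds x F).

Definition orthogonal_presentation alpha F (e : seq K') (fs : nat -> A) :=
  orthogonal v v' iota alpha e /\ F = \sum_(i < size e) e`_i *: S (fs i).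

(** The coefficients of F span a finite-dimensional K-subspace of K'; expand them in an orthogonal
    family and regroup. No point x is involved. *)
Lemma exists_orthogonal_presentation alpha F : 1 < alpha ->
  exists e fs, orthogonal_presentation alpha F e fs.
Proof.
move=> a1; have nil1 : orthogonal v v' iota 1 [::] by split.
have [e [eo hs]] :=
  orthogonal_extend hv hv' hiota [seq F@_u | u <- msupp F] (lexx 1) a1 nil1.
rewrite /= in eo hs.
have /choice[c hc] : forall u, exists c, u \in msupp F -> F@_u = comb iota e c.
  move=> u; have [uF|_] := boolP (u \in msupp F); last by exists (fun=> 0).
  by have [c] := hs _ (map_f (mcoeff^~ F) uF); exists c.
exists e, (fun i => \sum_(u <- msupp F) (<< c u i *g u >> : A)); split => //.
have scal_sum I (r : seq I) (G : I -> A) : S (\sum_(i <- r) G i) = \sum_(i <- r) S (G i).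
  exact: (big_morph S (@malg_scalD _ _ iota P) (malg_scal0 iota P)).
rewrite [LHS]malg_sumE; transitivity (\sum_(u <- msupp F) \sum_(i < size e)
   e`_i *: S (<< c u i *g u >> : A)).
  rewrite !big_seq; apply: eq_bigr => u uF; apply/malgP => w.
  rewrite mcoeffA_sum mcoeffU hc// /comb -sumrMnl; apply: eq_bigr => i _.
  by rewrite mcoeffAZ mcoeff_scal !mcoeffU rmorphMn mulrnAr mulrC.
rewrite exchange_big; apply: eq_bigr => i _.
by rewrite scal_sum scaler_sumr.
Qed.

(** An orthogonal presentation is optimal up to beta. Extend e so that it also spans the scalars of
    the competing presentation s. Comparing coefficients writes [fs i] as a K-combination of the
    second components of s, and orthogonality bounds its coefficients. *)
Lemma orthogonal_presentation_le alpha beta F e fs x C : 1 <= alpha -> alpha < beta ->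
  mult_seminorm v x -> orthogonal_presentation alpha F e fs ->
  presentation_bounds x F C ->
  forall i, (i < size e)%N -> v' e`_i * x (fs i) <= beta * C.
Proof.
move=> a1 ab hx [eo FE] [C0 [s Fs sC]] i ie.
have [e' [[e0' eo'] hs]] := orthogonal_extend hv hv' hiota (unzip1 s) a1 ab eo.
have b0 : 0 < beta by rewrite (lt_trans _ ab)// (lt_le_trans _ a1).
have /choice[c hc] : forall l, exists c, l \in unzip1 s -> l = comb iota (e ++ e') c.
  move=> l; have [ls|_] := boolP (l \in unzip1 s); last by exists (fun=> 0).
  by have [c hc] := hs _ ls; exists c.
have sz : size (e ++ e') = (size e + size e')%N by rewrite size_cat.
have fsE : fs i = \sum_(p <- s) c p.1 i *: p.2.
  apply/malgP => u; rewrite mcoeffA_sum.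
  (* The difference of the coefficients of the two presentations at u; it is a relation among the
     vectors of e ++ e' and hence vanishes. *)
  pose b k := \sum_(p <- s) c p.1 k * p.2@_u - (if (k < size e)%N then (fs k)@_u else 0).
  have b_eq0 : comb iota (e ++ e') b = 0.
    rewrite combB; apply/eqP; rewrite subr_eq0; apply/eqP; transitivity (F@_u).
      rewrite Fs mcoeffA_sum /comb.
      under eq_bigr => k _ do rewrite rmorph_sum mulr_suml.
      rewrite exchange_big/= !big_seq; apply: eq_bigr => p ps.
      rewrite mcoeffAZ mcoeff_scal {2}(hc p.1) ?map_f// /comb mulr_suml.
      by apply: eq_bigr => k _; rewrite rmorphM mulrAC.
    rewrite FE mcoeffA_sum /comb sz big_split_ord/= [X in _ = _ + X]big1 ?addr0.
      apply: eq_bigr => k _; rewrite mcoeffAZ mcoeff_scal ltn_ord nth_cat ltn_ord.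
      by rewrite mulrC.
    by move=> k _; rewrite ltnNge leq_addr rmorph0 mul0r.
  have ie' : (i < size (e ++ e'))%N by rewrite sz ltn_addr.
  have := eo' b i ie'; rewrite b_eq0 (nonarch_abs0 hv') mulr0.
  rewrite pmulr_lle0 ?(nonarch_abs_gt0 hv') ?e0'// => bi0.
  have /(nonarch_abs_eq0 hvn) : v (b i) = 0.
    by apply/eqP; rewrite eq_le bi0 (nonarch_abs_ge0 hvn).
  rewrite /b ie => /eqP; rewrite subr_eq0 => /eqP <-.
  by apply: eq_bigr => p _; rewrite mcoeffAZ.
have ei0 : 0 < v' e`_i by case: eo => e0 _; rewrite (nonarch_abs_gt0 hv') ?e0.
rewrite mulrC -ler_pdivlMr// fsE big_seq.
apply: (mult_seminorm_sum_le hvn hx); first by rewrite divr_ge0 ?mulr_ge0 ?(ltW b0) ?(ltW ei0).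
move=> p ps; rewrite (mult_seminormZ hx) ler_pdivlMr//.
have ie' : (i < size (e ++ e'))%N by rewrite sz ltn_addr.
have := eo' (c p.1) i ie'; rewrite -hc ?map_f// nth_cat ie => hci.
rewrite mulrAC (le_trans (ler_wpM2r (mult_seminorm_ge0 hx _) hci))//.
by rewrite -mulrA ler_wpM2l ?sC// ltW.
Qed.

Section FixX.
Variable x : A -> R.
Hypothesis hx : mult_seminorm v x.

Let t := tensor_seminorm x.

Let bounds_monomials F : exists C, presentation_bounds x F C.
Proof.
pose s := [seq (F@_u, << 1 *g u >> : A) | u <- msupp F].
exists (\sum_(p <- s) v' p.1 * x p.2); split.
  by apply: sumr_ge0 => p _; rewrite mulr_ge0 ?(nonarch_abs_ge0 hv') ?(mult_seminorm_ge0 hx).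
exists s.
  rewrite /presentation big_map [LHS]malg_sumE; apply: eq_bigr => u _ /=.
  by rewrite malg_scalU rmorph1 malg_scaleU mulr1.
move=> p ps; rewrite (big_rem p)//= lerDl sumr_ge0// => q _.
by rewrite mulr_ge0 ?(nonarch_abs_ge0 hv') ?(mult_seminorm_ge0 hx).
Qed.

Let bounds_inf F : has_inf (presentation_bounds x F).
Proof. by split; [exact: bounds_monomials|exists 0 => C []]. Qed.

Lemma tensor_seminorm_le F C : presentation_bounds x F C -> t F <= C.
Proof. by move=> H; apply: ge_inf; [case: (bounds_inf F)|]. Qed.

Lemma tensor_seminorm_ge F r :
  (forall C, presentation_bounds x F C -> r <= C) -> r <= t F.
Proof. by move=> H; apply: lb_le_inf; [case: (bounds_inf F)|]. Qed.

Lemma tensor_seminorm_lt F r : t F < r -> exists2 C, presentation_bounds x F C & C < r.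
Proof. by move=> /(inf_lt (bounds_inf F).1). Qed.

Lemma presentation_boundsM F G C C' : presentation_bounds x F C ->
  presentation_bounds x G C' -> presentation_bounds x (F * G) (C * C').
Proof.
move=> [C0 [s -> sC]] [C0' [s' -> sC']]; split; first exact: mulr_ge0.
exists [seq (p.1 * q.1, p.2 * q.2) | p <- s, q <- s'].
  rewrite /presentation mulr_suml big_allpairs_dep/=; apply: eq_bigr => p _.
  rewrite mulr_sumr; apply: eq_bigr => q _.
  by rewrite malg_scalM -scalerAl -scalerAr scalerA.
move=> _ /allpairsP[[p q] /= [ps qs' ->]] /=.
rewrite (nonarch_absM hv') (mult_seminormM hx) mulrACA.
by rewrite ler_pM ?sC ?sC'// mulr_ge0 ?(nonarch_abs_ge0 hv') ?(mult_seminorm_ge0 hx).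
Qed.

Lemma presentation_bounds_scalar c : presentation_bounds x (c%:A) (v' c).
Proof.
split; first exact: nonarch_abs_ge0 hv' _.
exists [:: (c, 1)]; first by rewrite /presentation big_seq1 malg_scal1.
by move=> p; rewrite inE => /eqP->; rewrite (mult_seminorm1 hvn hx) mulr1.
Qed.

Lemma presentation_boundsX F C n :
  presentation_bounds x F C -> presentation_bounds x (F ^+ n) (C ^+ n).
Proof.
move=> FC; elim: n => [|n IH]; last by rewrite !exprS; exact: presentation_boundsM.
by rewrite !expr0 -(scale1r 1) -(nonarch_abs1 hv'); exact: presentation_bounds_scalar.
Qed.

Lemma tensor_seminorm_scalar c : t c%:A <= v' c.
Proof. exact/tensor_seminorm_le/presentation_bounds_scalar. Qed.

Lemma tensor_seminorm_scal f : t (S f) <= x f.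
Proof.
apply: tensor_seminorm_le; split; first exact: mult_seminorm_ge0 hx _.
exists [:: (1, f)]; first by rewrite /presentation big_seq1 scale1r.
by move=> p; rewrite inE => /eqP->; rewrite (nonarch_abs1 hv') mul1r.
Qed.

Lemma tensor_seminorm_ge0 F : 0 <= t F.
Proof. by apply: tensor_seminorm_ge => C []. Qed.

(* Multiplication by S f preserves orthogonal presentations, as their coefficients
   in K' do not change. *)
Lemma tensor_seminorm_scalM f F : x f * t F <= t (S f * F).
Proof.
have [xf0|] := ltP 0 (x f); last first.
  move=> xf; apply: le_trans (tensor_seminorm_ge0 _).
  by rewrite mulr_le0_ge0 ?tensor_seminorm_ge0.
apply: tensor_seminorm_ge => C hC; have C0 : 0 <= C by case: hC.
(* One constant is needed for the presentation of F and a strictly larger one for the comparison, so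
   gam is put between 1 and alpha. *)
apply: le_mul_gt1 => // alpha a1; pose gam := (1 + alpha) / 2.
have g1 : 1 < gam by rewrite /gam; lra.
have ga : gam < alpha by rewrite /gam; lra.
have [e [fs [eo FE]]] := exists_orthogonal_presentation F g1.
have H := orthogonal_presentation_le (fs := fun i => f * fs i) (ltW g1) ga hx _ hC.
rewrite mulrC -ler_pdivlMr//; apply: tensor_seminorm_le; split.
  by rewrite divr_ge0 ?(ltW xf0)// mulr_ge0// (le_trans ler01 (ltW a1)).
exists [seq (e`_i, fs i) | i <- seq.iota 0 (size e)].
  rewrite /presentation big_map FE -(big_mkord xpredT (fun i => e`_i *: S (fs i))).
  by rewrite /index_iota subn0.
move=> p /mapP[i]; rewrite mem_iota/= add0n => ie ->/=.
rewrite ler_pdivlMr// -mulrA -(mult_seminormM hx) mulrC [fs i * f]mulrC mulrC.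
apply: H => //; split => //; rewrite FE mulr_sumr; apply: eq_bigr => j _.
by rewrite malg_scalM scalerAr.
Qed.

Lemma ring_seminorm_tensor : ring_seminorm t.
Proof.
split; first exact: tensor_seminorm_ge0.
- apply/eqP; rewrite eq_le tensor_seminorm_ge0 andbT.
  apply: tensor_seminorm_le; split => //; exists [::] => //.
  by rewrite /presentation big_nil.
- have := tensor_seminorm_scalar 1; rewrite scale1r (nonarch_abs1 hv') => t1.
  apply/eqP; rewrite eq_le t1/=.
  apply: tensor_seminorm_ge => C hC; have C0 : 0 <= C by case: hC.
  apply: le_mul_gt1 => // alpha a1.
  (* As iota is isometric, the family reduced to 1 is exactly orthogonal, which gives the lower
     bound for t 1. *)
  have oneo : orthogonal v v' iota 1 [:: 1].
    split=> [[|//] _|c [|//] _]; first exact: oner_neq0.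
    by rewrite /comb big_ord1 /= mulr1 (nonarch_abs1 hv') mulr1 hiota mul1r.
  have := orthogonal_presentation_le (e := [:: 1]) (fs := fun=> 1) (lexx 1) a1 hx _ hC (i := 0).
  rewrite /= (nonarch_abs1 hv') (mult_seminorm1 hvn hx) mulr1; apply => //.
  by split => //; rewrite big_ord1/= malg_scal1 scale1r.
- move=> F G; apply/ler_addgt0Pr => eps eps0; set r := _ + eps.
  have rM : Num.max (t F) (t G) < r by rewrite ltrDl.
  have /tensor_seminorm_lt[C [C0 [s -> sC]] Cr] : t F < r.
    by apply: le_lt_trans rM; rewrite le_max lexx.
  have /tensor_seminorm_lt[C' [C0' [s' -> sC']] Cr'] : t G < r.
    by apply: le_lt_trans rM; rewrite le_max lexx orbT.
  apply: tensor_seminorm_le; split; first exact: le_trans (ltW Cr).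
  exists (s ++ s'); first by rewrite /presentation big_cat.
  by move=> p; rewrite mem_cat => /orP[/sC|/sC'] /le_trans -> //; exact: ltW.
- move=> F G; apply: le_mul_approx; rewrite ?tensor_seminorm_ge0// => r r'.
  move=> /tensor_seminorm_lt[C hC Cr] /tensor_seminorm_lt[C' hC' Cr'].
  apply: le_trans (tensor_seminorm_le (presentation_boundsM hC hC')) _.
  by case: hC hC' => C0 _ [C0' _]; rewrite ler_pM// ltW.
Qed.

(** Together with [tensor_seminorm_scal] this forces multiplicative minorants obtained from t to
    restrict to x. *)
Lemma expanded_by_tensor :
  expanded_by (fun F r => 0 < r /\ exists2 f, F = S f & r = x f) t.
Proof.
move=> F r [r0 [f -> rE]]; split => // h; rewrite rE; exact: tensor_seminorm_scalM.
Qed.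

End FixX.
End Tensor.

(** * Shilov boundaries of compact sets of multiplicative seminorms *)

Section Pointwise.
Variables (R : realType) (T : choiceType).
Local Notation Fn := {ptws T -> R}.
Implicit Types (x y : Fn) (s : seq T) (d : R) (G : set Fn).

Definition cylinder s d x : set Fn :=
  [set y | forall t, t \in s -> `|y t - x t| < d].

Lemma eval_continuous (t : T) : continuous (fun x : Fn => x t).
Proof. exact: (@proj_continuous T (fun=> R) t). Qed.

Lemma nbhs_cylinder s d x : 0 < d -> nbhs x (cylinder s d x).
Proof.
move=> d0; elim: s => [|t s IH]; first by apply: filterS filterT => y _.
have /cvgrPdist_lt/(_ d d0) H : (fun y : Fn => y t) @ x --> x t by exact: eval_continuous.
near=> y => u; rewrite inE => /orP[/eqP->|us].
  by rewrite distrC; near: y; exact: H.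
by apply: (near IH y).
Unshelve. all: by end_near. Qed.

(** Cylinders around x generate a filter converging to x, since convergence may be tested at each
    evaluation; thus they form a neighborhood basis. *)
Lemma closed_cylinder G : closed G <->
  forall x, (forall s d, 0 < d -> exists2 y, G y & cylinder s d x y) -> G x.
Proof.
split=> [cG x H|H x clx]; last first.
  by apply: H => s d d0; have [y []] := clx _ (nbhs_cylinder s x d0); exists y.
apply: cG => B xB.
pose base := [set p : seq T * R | 0 < p.2].
pose cyl (p : seq T * R) := cylinder p.1 p.2 x.
have basis p q : base p -> base q ->
    exists2 r, base r & cyl r `<=` cyl p `&` cyl q.
  case: p q => [s d] [s' d'] /= d0 d0'.
  exists (s ++ s', Num.min d d'); first by rewrite /base /= lt_min d0.
  move=> y yr; split=> t ts; have := yr t; rewrite mem_cat ts ?orbT /=;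
  by rewrite lt_min => /(_ isT)/andP[].
have FF : Filter (filter_from base cyl).
  by apply: filter_from_filter => //; exists ([::], 1); rewrite /base /=.
have cvgx : filter_from base cyl --> x.
  apply/cvg_sup => t; rewrite cvg_image; last first.
    by rewrite eqEsubset; split=> // r _; exists (fun=> r).
  move=> W /= /nbhs_ballP[e /= e0 eW].
  exists ((fun y : Fn => y t) @^-1` W); last first.
    rewrite eqEsubset; split => [_ [y Wy <-]//|r Wr].
    by exists (fun=> r).
  exists ([:: t], e) => // y /(_ t (mem_head _ _)) /= yt.
  by apply: eW; rewrite /ball/= distrC.
have [[s d] /= d0 sB] := cvgx _ xB.
by have [y Gy xy] := H s d d0; exists y; split => //; exact: sB.
Qed.

Lemma notin_closed_cylinder G x : closed G -> ~ G x ->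
  exists s d, 0 < d /\ forall y, cylinder s d x y -> ~ G y.
Proof.
move=> /closed_cylinder cG Gx; apply: contrapT => H; apply: Gx; apply: cG => s d d0.
apply: contrapT => Hy; apply: H; exists s, d; split => // y xy Gy.
by apply: Hy; exists y.
Qed.

Lemma closed_notin_cylinder s d x : closed (~` cylinder s d x).
Proof.
apply/closed_cylinder => y H xy.
have [r r0 hr] : exists2 r, 0 < r & forall t, t \in s -> r <= d - `|y t - x t|.
  elim: s xy {H} => [|t s IH] xy; first by exists 1.
  have [|r r0 hr] := IH; first by move=> u us; apply: xy; rewrite inE us orbT.
  have xt := xy t (mem_head _ _).
  exists (Num.min r (d - `|y t - x t|)); first by rewrite lt_min r0 subr_gt0.
  move=> u; rewrite inE => /orP[/eqP->|/hr ur]; first by rewrite ge_min lexx orbT.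
  by rewrite ge_min ur.
have [z nz yz] := H s r r0; apply: nz => t ts.
have -> : z t - x t = (z t - y t) + (y t - x t) by ring.
rewrite (le_lt_trans (ler_normD _ _))// -ltrBrDr (lt_le_trans (yz t ts))//.
exact: hr.
Qed.

Lemma compact_eval_max G t : compact G -> G !=set0 ->
  exists2 y, G y & forall x, G x -> x t <= y t.
Proof.
move=> cG G0; have := @compact_EVT_max Fn R (fun x => x t) G G0 cG.
case.
  by apply: continuous_subspaceT => x; exact: eval_continuous.
by move=> y yG Hy; exists y; [exact: set_mem|move=> x Gx; apply: Hy; exact: mem_set].
Qed.

End Pointwise.

Lemma exists_lower_bound_seq (R : realType) (T : eqType) (s : seq T) (b : T -> R) :
  (forall t, t \in s -> 0 < b t) -> exists2 e, 0 < e & forall t, t \in s -> e <= b t.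
Proof.
elim: s => [|t s IH] H; first by exists 1.
have [|e e0 He] := IH; first by move=> u us; apply: H; rewrite inE us orbT.
exists (Num.min e (b t)); first by rewrite lt_min e0 H ?mem_head.
by move=> u; rewrite inE ge_min => /orP[/eqP->|/He->//]; rewrite lexx orbT.
Qed.

Lemma exists_upper_bound_seq (R : realType) (T : eqType) (s : seq T) (b : T -> R) :
  exists2 e, 0 <= e & forall t, t \in s -> b t <= e.
Proof.
exists (\sum_(t <- s) `|b t|); first exact: sumr_ge0.
move=> t ts; rewrite (big_rem t)//= (le_trans (ler_norm _))// lerDl.
exact: sumr_ge0.
Qed.

Lemma exists_root_gt1 (R : realType) (mu : R) n : 1 < mu ->
  exists2 l, 1 < l & l ^+ n.+1 = mu.
Proof.
move=> mu1; have n0 : n.+1%:R != 0 :> R by rewrite pnatr_eq0.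
have mu0 : 0 <= mu by rewrite ltW// (lt_trans _ mu1).
exists (mu `^ (n.+1%:R^-1)).
  have {1}<- : 1 `^ (n.+1%:R^-1) = 1 :> R by rewrite powR1.
  by apply: gt0_ltr_powR; rewrite ?invr_gt0 ?nnegrE.
by rewrite -powR_mulrn ?powR_ge0// -powRrM mulVf// powRr1.
Qed.

Section ProdBounds.
Variables (R : realType) (T : eqType).
Implicit Types (s : seq T) (a b : T -> R).

Lemma prodrMl_seq l s b : \prod_(t <- s) (l * b t) = l ^+ size s * \prod_(t <- s) b t.
Proof.
elim: s => [|t s IH]; first by rewrite !big_nil mulr1.
by rewrite !big_cons IH exprS; ring.
Qed.

Lemma prodr_le_seq s a b : (forall t, t \in s -> 0 <= a t <= b t) ->
  0 <= \prod_(t <- s) a t <= \prod_(t <- s) b t.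
Proof.
elim: s => [|t s IH] H; first by rewrite !big_nil ler01 lexx.
rewrite !big_cons; have /andP[a0 ab] := H t (mem_head _ _).
have /andP[p0 pab] : 0 <= \prod_(t <- s) a t <= \prod_(t <- s) b t.
  by apply: IH => u us; apply: H; rewrite inE us orbT.
by rewrite mulr_ge0// ler_pM.
Qed.

Lemma prodr_gt0_seq s b : (forall t, t \in s -> 0 < b t) -> 0 < \prod_(t <- s) b t.
Proof.
elim: s => [|t s IH] H; first by rewrite big_nil.
by rewrite big_cons mulr_gt0 ?H ?mem_head// IH// => u us; apply: H; rewrite inE us orbT.
Qed.

(** No factor exceeds its bound, so a product that loses at most kappa in total loses at most kappa
    in each factor. *)
Lemma prodr_factors_ge s a b phi kappa :
  (forall t, t \in s -> 0 < b t) -> (forall t, t \in s -> 0 <= a t <= b t) ->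
  0 <= phi <= 1 -> kappa * \prod_(t <- s) b t <= phi * \prod_(t <- s) a t ->
  kappa <= phi /\ forall t, t \in s -> kappa * b t <= a t.
Proof.
move=> b0 ab /andP[phi0 phi1] H; split.
  rewrite -(ler_pM2r (prodr_gt0_seq b0)) (le_trans H)// ler_wpM2l//.
  by case/andP: (prodr_le_seq ab).
move=> t ts; have remP u : u \in rem t s -> u \in s by move/mem_rem.
have b0' := prodr_gt0_seq (fun u us => b0 u (remP u us)).
have bE : \prod_(u <- s) b u = b t * \prod_(u <- rem t s) b u by rewrite (big_rem t).
rewrite -(ler_pM2r b0') -mulrA -bE (le_trans H)// (big_rem t)//=.
have /andP[p0 pab] := prodr_le_seq (fun u us => ab u (remP u us)).
have /andP[a0 _] := ab t ts.
by rewrite mulrCA ler_wpM2l// (le_trans _ pab)// ler_piMl.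
Qed.

End ProdBounds.

(** * Minimal and least boundaries *)

Section Shilov.
Variables (R : realType) (A : comNzRingType).
Local Notation Fn := {ptws A -> R}.
Implicit Types (X G S : set Fn) (x y : Fn).

Definition algebraic_boundary X G : Prop :=
  [/\ closed G, G `<=` X & forall f, exists2 g, G g & forall x, X x -> x f <= g f].

Definition least_boundary X G : Prop :=
  algebraic_boundary X G /\ forall H, algebraic_boundary X H -> G `<=` H.

Variable X : set Fn.
Hypotheses (cX : compact X) (clX : closed X) (X0 : X !=set0).
Hypothesis Xge0 : forall x f, X x -> 0 <= x f.
Hypothesis X1 : forall x, X x -> x 1 = 1.
Hypothesis XM : forall x f g, X x -> x (f * g) = x f * x g.

Let XX x f n : X x -> x (f ^+ n) = x f ^+ n.
Proof. by move=> Xx; elim: n => [|n IH]; rewrite ?expr0 ?X1// !exprS XM// IH. Qed.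

Let Xprod x (s : seq A) : X x -> x (\prod_(f <- s) f) = \prod_(f <- s) x f.
Proof.
move=> Xx; elim: s => [|f s IH]; first by rewrite !big_nil X1.
by rewrite !big_cons XM// IH.
Qed.

Lemma exists_minimal_boundary : exists S, algebraic_boundary X S /\
  forall S', algebraic_boundary X S' -> S' `<=` S -> S `<=` S'.
Proof.
have bX : algebraic_boundary X X.
  by split => // f; exact: compact_eval_max.
pose B := {S | algebraic_boundary X S}.
pose le (S S' : B) := `[< sval S' `<=` sval S >].
have [||F Ftot|[S bS] Smin] := @ZL_preorder B (exist _ X bX) le.
- by move=> S; apply/asboolP.
- by move=> S1 S2 S3 /asboolP h /asboolP h'; apply/asboolP; exact: subset_trans h.
- have [->|/set0P[S0 FS0]] := eqVneq F set0; first by exists (exist _ X bX).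
  pose I := \bigcap_(S in F) sval S.
  have bI : algebraic_boundary X I.
    split.
    + by apply: closed_bigI => S _; case: (svalP S).
    + by move=> x Ix; case: (svalP S0) => _ + _; apply; exact: Ix.
    move=> f; have [m Xm mmax] := compact_eval_max f cX X0.
    (* The points of a member of the chain where f is maximal on X form a nonempty closed set. These
       sets are nested, and a cluster point lies in all of them. *)
    pose M (S : B) := sval S `&` [set x | m f <= x f].
    have M0 (S : B) : F S -> M S !=set0.
      by move=> _; have [_ _ /(_ f)[g Sg gmax]] := svalP S; exists g; split => //; exact: gmax.
    have PF : ProperFilter (filter_from F M).
      apply: filter_from_proper => //; apply: filter_from_filter; first by exists S0.
      move=> S S' FS FS'; have [/asboolP h|/asboolP h] := Ftot _ _ FS FS'.
        by exists S' => // x [S'x mx]; split; split => //; exact: h.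
      by exists S => // x [S'x mx]; split; split => //; exact: h.
    have [x [Xx clx]] : X `&` cluster (filter_from F M) !=set0.
      apply: cX; exists S0 => // x [S0x _].
      by case: (svalP S0) => _ + _; apply.
    have xM (S : B) : F S -> M S x.
      move=> FS; have clM : closed (M S).
        apply: closedI; first by case: (svalP S).
        apply: (@closed_comp _ _ (fun x : Fn => x f) [set r | m f <= r]).
          by move=> y _; exact: eval_continuous.
        exact: closed_ge.
      by apply: clM => N xN; apply: clx => //; exists S.
    exists x; first by move=> S /xM[].
    by move=> y Xy; apply: le_trans (mmax y Xy) _; case: (xM S0 FS0).
  exists (exist _ I bI) => S FS; apply/asboolP => x; apply => //.
exists S; split => // S' bS' S'S.
have /Smin/asboolP : le (exist _ S bS) (exist _ S' bS') by apply/asboolP.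
by [].
Qed.

(* If x lies in a minimal boundary S but not in G, some f attains its maximum on S
   only near x. For the g_1, ..., g_k defining a neighborhood of x disjoint from G
   and n large, f^(n (k + 1)) g_1 ... g_k is then large only in this neighborhood,
   so that it does not attain its maximum on G. *)
Theorem exists_least_boundary : exists S, least_boundary X S.
Proof.
have [S [bS Smin]] := exists_minimal_boundary.
exists S; split => // G [cG GX Gmax] x Sx; apply: contrapT => Gx.
have [clS SX Smax] := bS.
have Xx := SX x Sx.
have [s [d [d0 sG]]] := notin_closed_cylinder cG Gx.
have [M M0 HM] := exists_upper_bound_seq s x.
(* Since x g <= M on s, agreement of y g and x g up to a factor mu puts y g within d of x g. *)
pose mu := 1 + d / (M + 1).
have M1 : 0 < M + 1 by rewrite ltr_wpDl.
have mu1 : 1 < mu by rewrite ltrDl divr_gt0.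
have mu0 : 0 < mu by apply: lt_trans mu1.
(* Elements vanishing at x would spoil the product; they are controlled separately, through eps. *)
pose sp := [seq g <- s | 0 < x g]; pose k := size sp.
(* The estimates lose l once for each of the k factors at s0 and once for each bound l * x g; one
   further l is kept in reserve, which gives 2k + 1 in all. *)
have [l l1 lmu] := exists_root_gt1 (k + k) mu1.
have l0 : 0 < l by apply: lt_trans l1.
pose eps := d / (mu + mu).
have eps0 : 0 < eps by rewrite divr_gt0// addr_gt0.
(* With eta <= x g (1 - 1/l), a change of x g by eta stays between x g / l and l * x g. *)
pose b g := if 0 < x g then x g * (1 - l^-1) else eps.
have b0 g : 0 < b g.
  rewrite /b; case: ifP => // xg; rewrite mulr_gt0// subr_gt0 invf_lt1//.
have [eta eta0 Heta] := exists_lower_bound_seq (fun g (_ : g \in s) => b0 g).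
pose U := cylinder s eta x.
(* By minimality the part of S outside U is not a boundary, which provides f; if that part is empty,
   f = 1 will do. *)
have [f [Hf [y0 Xy0 fy0]]] : exists f,
    (forall y, S y -> ~ U y -> exists2 z, X z & y f < z f) /\
    exists2 z, X z & 0 < z f.
  have [[z [Sz Uz]]|noz] := pselect (exists z, S z /\ ~ U z); last first.
    exists 1; split; last by exists x; rewrite ?X1.
    by move=> y Sy Uy; case: noz; exists y.
  suff [f Hf] : exists f, forall y, S y -> ~ U y -> exists2 z, X z & y f < z f.
    exists f; split => //; have [z' Xz' zz'] := Hf z Sz Uz; exists z' => //.
    exact: le_lt_trans (Xge0 f (SX _ Sz)) zz'.
  apply: contrapT => H.
  have bSU : algebraic_boundary X (S `&` ~` U).
    split; first by apply: closedI => //; exact: closed_notin_cylinder.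
      by move=> y [/SX].
    move=> f; apply: contrapT => Hf; apply: H; exists f => y Sy Uy.
    apply: contrapT => Hy; apply: Hf; exists y => // w Xw.
    by rewrite leNgt; apply/negP => yw; apply: Hy; exists w.
  have [_] := Smin _ bSU (@subIsetl _ _ _) x Sx; apply => t ts.
  by rewrite subrr normr0.
have [s0 Ss0 s0max] := Smax f.
have Xs0 := SX _ Ss0.
pose p := s0 f.
have Us0 : U s0.
  apply: contrapT => /(Hf _ Ss0)[z Xz]; apply/negP; rewrite -leNgt; exact: s0max.
have [p1 [p10 p1p Hp1]] : exists p1, [/\ 0 <= p1, p1 < p &
    forall y, S y -> ~ U y -> y f <= p1].
  have cSU : compact (S `&` ~` U).
    apply: (subclosed_compact _ cX); last by move=> y [/SX].
    by apply: closedI => //; exact: closed_notin_cylinder.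
  have [/set0P SU0|] := boolP (S `&` ~` U != set0).
    have [z [Sz Uz] zmax] := compact_eval_max f cSU SU0.
    exists (z f); split; first exact/Xge0/SX.
      by have [w Xw] := Hf _ Sz Uz; move/lt_le_trans; apply; exact: s0max.
    by move=> y Sy Uy; exact: zmax.
  rewrite negbK => /eqP SU0.
  have noU y : S y -> ~ U y -> False.
    by move=> Sy Uy; have : (S `&` ~` U) y by []; rewrite SU0.
  exists 0; split => //; first exact: lt_le_trans fy0 (s0max _ Xy0).
  by move=> y Sy /(noU _ Sy).
have p0 : 0 < p by apply: le_lt_trans p1p.
have [bd bd0 Hbd] : exists2 bd, 0 <= bd & forall y g, X y -> g \in s -> y g <= bd.
  have /choice[m Hm] : forall g, exists y, X y /\ forall z, X z -> z g <= y g.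
    by move=> g; have [y Xy ymax] := compact_eval_max g cX X0; exists y.
  have [bd bd0 H] := exists_upper_bound_seq s (fun g => m g g).
  by exists bd => // y g Xy gs; apply: le_trans (H g gs); case: (Hm g) => _; apply.
(* This n makes f^n g smaller than p^n eta at the points of S outside U, where f <= p1 < p. *)
have [n Hn] : exists n, (p1 / p) ^+ n < eta / (bd + 1).
  apply: expr_small; first by rewrite divr_ge0 ?(ltW p0)// ltr_pdivrMr// mul1r.
  by rewrite divr_gt0// ltr_wpDl.
have fg y g : X y -> g \in s -> y f ^+ n * y g <= p ^+ n * (x g + eta).
  move=> Xy gs; have [z Sz zmax] := Smax (f ^+ n * g).
  have Xz := SX _ Sz.
  have := zmax y Xy; rewrite !XM// !XX// => /le_trans; apply.
  have xg0 : 0 <= x g by exact: Xge0.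
  have [Uz|Uz] := pselect (U z).
    rewrite ler_pM ?exprn_ge0 ?Xge0//; last first.
      by rewrite -lerBlDl ltW// (le_lt_trans (ler_norm _))// Uz.
    by rewrite lerXn2r ?nnegrE ?Xge0 ?(ltW p0)// s0max.
  apply: (@le_trans _ _ (p1 ^+ n * (bd + 1))).
    rewrite ler_pM ?exprn_ge0 ?Xge0//.
      by apply: lerXn2r; rewrite ?nnegrE ?(Xge0 _ Xz)//; exact: Hp1.
    by rewrite (le_trans (Hbd z g Xz gs))// lerDl.
  apply: (@le_trans _ _ (p ^+ n * eta)); last first.
    by rewrite ler_wpM2l ?exprn_ge0 ?(ltW p0)// lerDr.
  have bd1 : 0 < bd + 1 by rewrite ltr_wpDl.
  rewrite -ler_pdivlMr// -mulrA mulrC -ler_pdivrMr ?exprn_gt0// -expr_div_n; exact: ltW.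
(* There is one f^n for each g in sp and one more, so that phi itself gets bounded from below; this
   is needed where x g = 0. *)
have [y Gy ymax] := Gmax (f ^+ (n * k.+1) * \prod_(g <- sp) g).
have Xy := GX _ Gy.
pose phi := (y f / p) ^+ n.
have phi0 : 0 <= phi by rewrite exprn_ge0// divr_ge0 ?Xge0 ?(ltW p0).
have phi1 : phi <= 1.
  by rewrite exprn_ile1 ?divr_ge0 ?Xge0 ?(ltW p0)// ler_pdivrMr// mul1r s0max.
have phig g : g \in s -> phi * y g <= x g + eta.
  move=> gs; rewrite /phi expr_div_n mulrAC ler_pdivrMr ?exprn_gt0// mulrC [leRHS]mulrC.
  rewrite [y g * _]mulrC; exact: fg.
have sps g : g \in sp -> g \in s by rewrite mem_filter => /andP[].
have spx g : g \in sp -> 0 < x g by rewrite mem_filter => /andP[].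
have etal g : g \in sp -> eta <= x g * (1 - l^-1).
  by move=> gs; have := Heta g (sps g gs); rewrite /b spx.
have lV1 : l^-1 < 1 by rewrite invf_lt1.
have lV0 : 0 < l^-1 by rewrite invr_gt0.
have lVl : l^-1 * l = 1 by rewrite mulVf// gt_eqF.
have s0g g : g \in sp -> l^-1 * x g <= s0 g.
  move=> gs; have := Us0 g (sps g gs); rewrite ltr_norml => /andP[h _].
  have := etal g gs; have := spx g gs; nra.
(* Compares the value at y, maximal on X, with the value at s0, where f equals p and each g is at
   least x g / l. *)
have main : (l ^- (k + k)) * \prod_(g <- sp) (l * x g) <=
    phi * \prod_(g <- sp) (phi * y g).
  rewrite !prodrMl_seq -/k.
  have := ymax s0 Xs0; rewrite !XM// !XX// !Xprod// !exprM -/p => H.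
  have {}H : \prod_(g <- sp) s0 g <= phi ^+ k.+1 * \prod_(g <- sp) y g.
    rewrite -(@ler_pM2l _ (p ^+ n ^+ k.+1)) ?exprn_gt0// (le_trans H)//.
    rewrite mulrA -exprMn /phi expr_div_n mulrC [X in _ <= X * _](_ : _ = y f ^+ n ^+ k.+1).
      by rewrite mulrC.
    by congr (_ ^+ _); rewrite mulrC divfK// gt_eqF// exprn_gt0.
  rewrite mulrA -exprS; apply: le_trans H.
  have -> : l ^- (k + k) * (l ^+ k * \prod_(g <- sp) x g) =
      \prod_(g <- sp) (l^-1 * x g).
    rewrite prodrMl_seq -/k mulrA; congr (_ * _).
    by rewrite exprD invfM -mulrA mulVf ?mulr1 ?exprVn// expf_neq0// gt_eqF.
  suff /prodr_le_seq/andP[] : forall g, g \in sp -> 0 <= l^-1 * x g <= s0 g by [].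
  by move=> g gs; rewrite s0g// mulr_ge0 ?(ltW lV0)// ltW// spx.
have [|||kphi ky] := prodr_factors_ge _ _ _ main.
- by move=> g gs; rewrite mulr_gt0// spx.
- move=> g gs; rewrite mulr_ge0 ?Xge0//= (le_trans (phig g (sps g gs)))//.
  have := etal g gs; have := spx g gs; nra.
- by rewrite phi0.
have kE : l ^- (k + k) = l / mu.
  rewrite -lmu exprS invfM mulrA mulfV ?mul1r// gt_eqF//.
rewrite kE in kphi ky.
apply: (sG y) => // g gs.
have yg0 : 0 <= y g by exact: Xge0.
have xg0 : 0 <= x g by exact: Xge0.
have gM := HM g gs.
have muphi : l <= mu * phi by move: kphi; rewrite ler_pdivrMr// mulrC.
have muM : mu * (M + 1) = M + 1 + d by rewrite /mu mulrDl mul1r divfK// gt_eqF.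
have [xg|xg] := ltP 0 (x g).
  have gsp : g \in sp by rewrite mem_filter xg gs.
  have h1 : x g <= mu * y g.
    have := ky g gsp; rewrite mulrAC ler_pdivrMr//.
    have hy : phi * y g <= y g by rewrite ler_piMl.
    have hy' : phi * y g * mu <= mu * y g by rewrite mulrC ler_pM2l.
    have hx : x g <= l * x g by rewrite ler_peMl// ltW.
    have hx' : l * x g <= l * (l * x g) by rewrite ler_pM2l.
    by move=> h; rewrite (le_trans hx)// (le_trans hx')// (le_trans h).
  have h2 : y g <= mu * x g.
    have := phig g gs; have := etal g gsp => h3 h4.
    have h5 : phi * y g <= l * x g by nra.
    have h6 : l * y g <= mu * (phi * y g) by rewrite mulrA ler_wpM2r.
    have h7 : mu * (phi * y g) <= mu * (l * x g) by rewrite ler_pM2l.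
    rewrite -(ler_pM2l l0) (le_trans h6)// (le_trans h7)// le_eqVlt; apply/orP; left.
    by apply/eqP; ring.
  rewrite ltr_norml; apply/andP; split; nra.
have xgE : x g = 0 by apply/eqP; rewrite eq_le xg.
have h3 := phig g gs; have := Heta g gs; rewrite /b xgE ltxx => h4.
rewrite subr0 ger0_norm//; rewrite xgE add0r in h3.
have h5 : eps * (mu + mu) = d by rewrite divfK// gt_eqF// addr_gt0.
nra.
Qed.

End Shilov.

(** * Boundaries and extension of scalars *)

Section LimitPoint.
Variables (R : realType) (T : choiceType).
Local Notation Fn := {ptws T -> R}.

Lemma compact_limit_point (G : set Fn) (z : nat -> Fn) :
  compact G -> (forall n, G (z n)) ->
  exists2 x, G x & forall s d m, 0 < d -> exists2 n, (m <= n)%N & cylinder s d x (z n).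
Proof.
move=> cG Gz; have [|x [Gx clx]] := cG (z @ \oo) _ _.
  by exists 0 => // n _; exact: Gz.
exists x => // s d m d0.
have zm : (z @ \oo) [set z n | n in [set n | (m <= n)%N]].
  by exists m => // n mn; exists n.
by have [_ [[n mn <-] xz]] := clx _ _ zm (nbhs_cylinder s x d0); exists n.
Qed.

End LimitPoint.

Section BaseChange.
Variables (R : realType) (K K' : fieldType) (v : K -> R) (v' : K' -> R).
Hypotheses (hv : complete_nonarch v) (hv' : nonarch_abs v').
Variable iota : {rmorphism K -> K'}.
Hypothesis hiota : forall a, v' (iota a) = v a.
Variable P : nmodType.
Local Notation A := (monoidAlg K P).
Local Notation A' := (monoidAlg K' P).
Local Notation S := (@malg_scal K K' iota P).
Implicit Types (x : A -> R) (y : A' -> R) (f g : A) (F : A').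

Let hvn := complete_nonarch_abs hv.

Definition seminorm_restr y : A -> R := fun f => y (S f).

(** The last hypothesis says that the tensor seminorm of F^n is at least c rho^n. It is phrased
    through single presentations, since these are what can be estimated. *)
Lemma exists_extension x F c rho : mult_seminorm v x -> 0 < c -> 0 < rho ->
  (forall n C, presentation_bounds v' iota x (F ^+ n) C -> c * rho ^+ n <= C) ->
  exists y, [/\ mult_seminorm v' y, seminorm_restr y = x & rho <= y F].
Proof.
move=> hx c0 rho0 H.
have ht := ring_seminorm_tensor hv hv' hiota hx.
have [|y [[hy yM] yt yx yF]] := exists_large_multiplicative_seminorm ht
    (expanded_by_tensor hv hv' hiota hx) c0 rho0 (F := F).
  by move=> n; apply: (tensor_seminorm_ge hv' hx) => C; exact: H.
exists y; split => //.
  have yle a : y a%:A <= v' a.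
    exact: le_trans (yt _) (tensor_seminorm_scalar hv hv' iota hx a).
  split=> [||f g|//]; [exact: rsn_ge0|move=> a|exact: rsnD].
  have [->|a0] := eqVneq a 0; first by rewrite scale0r (rsn0 hy) (nonarch_abs0 hv').
  apply/eqP; rewrite eq_le yle /=.
  have va := nonarch_abs_gt0 hv' a0.
  (* The upper bounds for a and for its inverse force equality, as the values multiply to 1. *)
  have : y (a%:A * a^-1%:A) = 1.
    by rewrite -scalerAl mul1r scalerA mulfV// scale1r (rsn1 hy).
  rewrite yM => ya1.
  have : v' (a * a^-1) = 1 by rewrite mulfV// (nonarch_abs1 hv').
  rewrite (nonarch_absM hv') => va1.
  rewrite -[leLHS]mulr1 -ya1 mulrCA ler_piMr ?(rsn_ge0 hy)//.
  by rewrite -va1 ler_pM2l.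
apply/funext => f; apply/eqP; rewrite eq_le /seminorm_restr.
rewrite (le_trans (yt _) (tensor_seminorm_scal hv' iota hx f))/=.
have [xf|] := ltP 0 (x f); first by apply: yx; split => //; exists f.
by move=> /le_trans; apply; exact: rsn_ge0 hy _.
Qed.

Variables (X : set {ptws A -> R}) (X' : set {ptws A' -> R}).
Hypotheses (cX : compact X) (clX : closed X) (cX' : compact X') (clX' : closed X').
Hypothesis hX : forall x, X x -> mult_seminorm v x.
Hypothesis X'E : forall y, X' y <-> mult_seminorm v' y /\ X (seminorm_restr y).

Lemma seminorm_restr_surj x : X x -> exists2 y, X' y & seminorm_restr y = x.
Proof.
move=> Xx; have hx := hX Xx.
have [|y [hy yx _]] := @exists_extension x 1 1 1 hx ltr01 ltr01.
  move=> n C; rewrite !expr1n mulr1 => /(tensor_seminorm_le hv' hx).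
  by rewrite (rsn1 (ring_seminorm_tensor hv hv' hiota hx)).
by exists y => //; apply/X'E; rewrite yx.
Qed.

(* For each m, rho^m is at most twice the tensor seminorm of F^m at some point of G;
   the points for m = n! accumulate at a point of G that works for all m. *)
Lemma boundary_large_extension G F rho : algebraic_boundary X G -> 0 < rho ->
  (exists2 y, X' y & rho <= y F) ->
  exists y, [/\ X' y, G (seminorm_restr y) & rho <= y F].
Proof.
move=> [clG GX Gmax] rho0 [y0 /X'E[hy0 Xy0] rhoy0].
have cG : compact G by exact: subclosed_compact cX GX.
pose Z m x := forall C, presentation_bounds v' iota x (F ^+ m) C -> rho ^+ m <= 2 * C.
have Z0 m : exists2 x, G x & Z m x.
  have a1 : (1 : R) < 3 / 2 by lra.
  have a2 : (3 / 2 : R) < 2 by lra.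
  have [e [fs [eo FE]]] := exists_orthogonal_presentation hv hv' hiota (F ^+ m) a1.
  have [i ie hi] : exists2 i, (i < size e)%N & rho ^+ m <= v' e`_i * y0 (S (fs i)).
    apply: contrapT => H.
    have lt_i (i : 'I_(size e)) : v' e`_i * y0 (S (fs i)) < rho ^+ m.
      by rewrite ltNge; apply/negP => hi; apply: H; exists i.
    (* Finitely many strict inequalities have a common gap; the maximum with 0 keeps the bound
       nonnegative. *)
    have [b b0 hb] : exists2 b, b < rho ^+ m &
        0 <= b /\ forall i : 'I_(size e), v' e`_i * y0 (S (fs i)) <= b.
      have [|d d0 hd] := @exists_lower_bound_seq R _ (enum 'I_(size e))
         (fun i => rho ^+ m - v' e`_i * y0 (S (fs i))).
        by move=> i _; rewrite subr_gt0.
      exists (Num.max 0 (rho ^+ m - d)).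
        by rewrite gt_max exprn_gt0//= gtrBl.
      split; first by rewrite le_max lexx.
      move=> i; rewrite le_max; apply/orP; right.
      by rewrite lerBrDr -lerBrDl hd// mem_enum.
    case: hb => b1 hb; have : y0 (F ^+ m) <= b.
      rewrite FE; apply: (mult_seminorm_sum_le hv' hy0) => // i _.
      by rewrite (mult_seminormZ hy0).
    rewrite (mult_seminormX hv' hy0) leNgt => /negP; apply.
    by rewrite (lt_le_trans b0)// lerXn2r ?nnegrE ?(ltW rho0) ?(mult_seminorm_ge0 hy0).
  (* At a point x of G where [fs i] is maximal on X, the same orthogonal presentation bounds the
     tensor seminorm of F^m from below. *)
  have [x Gx xmax] := Gmax (fs i); exists x => // C hC.
  have := orthogonal_presentation_le hv hv' hiota (ltW a1) a2 (hX (GX _ Gx)) (conj eo FE) hC ie.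
  apply: le_trans; rewrite (le_trans hi)// ler_wpM2l ?(nonarch_abs_ge0 hv')//.
  exact: (xmax _ Xy0).
(* A bound C for F^m gives C^k for F^(mk), and 2 <= 2^k for k > 0; so Z passes to divisors of the
   exponent. *)
have Zmul m k x : X x -> (0 < k)%N -> Z (m * k)%N x -> Z m x.
  move=> Xx k0 Zx C hC; have C0 : 0 <= C by case: hC.
  have := Zx _ (_ : presentation_bounds v' iota x (F ^+ (m * k)) (C ^+ k)).
  rewrite exprM => /(_ (presentation_boundsX hv hv' (hX Xx) _ hC)) => H.
  rewrite leNgt; apply/negP => lt2C.
  have : (2 * C) ^+ k < (rho ^+ m) ^+ k.
    by rewrite ltrXn2r ?nnegrE ?mulr_ge0// ?exprn_ge0 ?(ltW rho0)// -lt0n.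
  rewrite -exprM ltNge => /negP; apply; apply: le_trans H _.
  rewrite exprMn ler_wpM2r ?exprn_ge0//.
  by case: k k0 {Zx} => // k _; rewrite exprS ler_peMr// exprn_ege1// ler1n.
have /choice[z hz] : forall n, exists x, G x /\ Z n`!%N x.
  by move=> n; have [x Gx Zx] := Z0 n`!%N; exists x.
have [x Gx xlim] := @compact_limit_point R A G z cG (fun n => (hz n).1).
have Xx := GX _ Gx.
have Zx m : (0 < m)%N -> Z m x.
  (* A given presentation involves only finitely many elements of A, so some z n with n >= m
     satisfies its bound with C relaxed to r'. *)
  move=> m0 C [C0 [s FE sC]]; apply: le_mul_approx => // r r' r2 rC.
  have [|d d0 hd] := @exists_lower_bound_seq R _ s (fun p => (r' - C) / (v' p.1 + 1)).
    by move=> p _; rewrite divr_gt0 ?subr_gt0// ltr_wpDl ?(nonarch_abs_ge0 hv').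
  have [n mn xz] := xlim [seq p.2 | p <- s] d m d0.
  have Gz := (hz n).1.
  have Zz : Z m (z n).
    apply: (@Zmul m (n`! %/ m)%N _ (GX _ Gz)).
      by rewrite divn_gt0// dvdn_leq ?fact_gt0// dvdn_fact// m0.
    by rewrite mulnC divnK ?dvdn_fact ?m0//; exact: (hz n).2.
  apply: le_trans (Zz r' _) _; last by rewrite ler_pM// ?ltW// (le_lt_trans C0).
  split; first by rewrite (le_trans C0)// ltW.
  exists s => // p ps.
  have pd := hd p ps.
  have := xz p.2 (map_f snd ps); rewrite ltr_norml => /andP[_ zx].
  have v0 : 0 <= v' p.1 by exact: nonarch_abs_ge0 hv' _.
  have pC := sC p ps.
  have d1 : d * (v' p.1 + 1) <= r' - C by rewrite -ler_pdivlMr// ltr_wpDl.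
  nra.
have [||y [hy yx yF]] := @exists_extension x F 2^-1 rho (hX Xx) _ rho0.
- by rewrite invr_gt0.
- move=> m C hC; rewrite mulrC ler_pdivrMr// mulrC.
  (* The exponent 0 divides no factorial; there the value t 1 = 1 suffices. *)
  case: m hC => [|m] hC; last exact: Zx.
  have t1 := rsn1 (ring_seminorm_tensor hv hv' hiota (hX Xx)).
  have := tensor_seminorm_le hv' (hX Xx) hC; rewrite !expr0 t1 => C1.
  by rewrite (le_trans C1)// ler_peMl ?ler1n// (le_trans ler01).
exists y; rewrite yx; split => //; apply/X'E; rewrite yx; split=> //.
Qed.

Lemma boundary_preimage G : algebraic_boundary X G -> X !=set0 ->
  algebraic_boundary X' [set y | X' y /\ G (seminorm_restr y)].
Proof.
move=> bG [x0 Xx0]; have [clG GX Gmax] := bG.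
have [y0 X'y0 _] := seminorm_restr_surj Xx0.
split; last first.
- move=> F; have [y X'y ymax] := compact_eval_max F cX' (ex_intro _ _ X'y0).
  have hy1 := (X'E _).1 X'y.
  have [yF|] := ltP 0 (y F).
    have [|y1 [X'y1 Gy1 y1F]] := boundary_large_extension bG yF (F := F).
      by exists y.
    by exists y1 => // z X'z; apply: le_trans (ymax z X'z) _.
  (* If F vanishes on X', any point above G is a maximum; F = 1 provides one. *)
  move=> yF; have [|y1 [X'y1 Gy1 _]] := boundary_large_extension bG ltr01 (F := 1).
    by exists y => //; rewrite (mult_seminorm1 hv' hy1.1).
  exists y1 => // z X'z; apply: le_trans (ymax z X'z) _.
  by apply: le_trans yF _; apply: mult_seminorm_ge0 ((X'E _).1 X'y1).1 _.
- by move=> y [].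
apply/closed_cylinder => y H; split.
  by move/closed_cylinder: clX'; apply => s d d0; have [z [X'z _]] := H s d d0; exists z.
move/closed_cylinder: clG; apply => s d d0.
have [z [_ Gz] yz] := H [seq S f | f <- s] d d0.
by exists (seminorm_restr z) => // f fs; apply: yz; exact: map_f.
Qed.

(** As restriction is onto, f has the same maximum on X as S f on X'. The image is closed because G'
    is compact: the points of G' restricting close to x cluster at one restricting to x. *)
Lemma boundary_image G' : algebraic_boundary X' G' ->
  algebraic_boundary X (seminorm_restr @` G').
Proof.
move=> [clG' G'X Gmax]; have cG' : compact G' by exact: subclosed_compact cX' G'X.
split; last first.
- move=> f; have [y Gy ymax] := Gmax (S f); exists (seminorm_restr y); first by exists y.
  by move=> x /seminorm_restr_surj[z X'z <-]; exact: ymax.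
- by move=> _ [y /G'X/X'E[_ Xy] <-].
apply/closed_cylinder => x H.
pose base := [set p : seq A * R | 0 < p.2].
pose cyl (p : seq A * R) := G' `&` [set y | cylinder p.1 p.2 x (seminorm_restr y)].
have PF : ProperFilter (filter_from base cyl).
  apply: filter_from_proper; last first.
    by move=> [s d] /= d0; have [_ [y Gy <-] xy] := H s d d0; exists y.
  apply: filter_from_filter; first by exists ([::], 1); rewrite /base /=.
  move=> [s d] [s' d'] /= d0 d0'.
  exists (s ++ s', Num.min d d'); first by rewrite /base /= lt_min d0.
  move=> y [Gy yr]; split; split=> // t ts; have := yr t; rewrite mem_cat ts ?orbT /=;
  by rewrite lt_min => /(_ isT)/andP[].
have [|y [Gy cly]] := cG' (filter_from base cyl) PF _.
  by exists ([::], 1); [rewrite /base /=|move=> y []].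
exists y => //; apply/funext => f; apply/eqP; rewrite -subr_eq0 -normr_eq0 eq_le normr_ge0 andbT.
apply/ler_addgt0Pr => e e0; rewrite add0r.
have e20 : 0 < e / 2 by rewrite divr_gt0.
have cf : filter_from base cyl (cyl ([:: f], e / 2)) by exists ([:: f], e / 2).
have [z [[Gz /(_ f (mem_head _ _)) zx] /(_ (S f) (mem_head _ _)) zy]] :=
  cly _ _ cf (nbhs_cylinder [:: S f] y e20).
rewrite /= in zx.
have -> : seminorm_restr y f - x f = (seminorm_restr z f - x f) - (z (S f) - y (S f)).
  by rewrite /seminorm_restr; ring.
by rewrite (le_trans (ler_normB _ _))// [e]splitr; apply: lerD; exact: ltW.
Qed.

Lemma exists_least_boundary_restr : X !=set0 -> exists G, least_boundary X G.
Proof.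
move=> X0; apply: exists_least_boundary => //.
- by move=> x f /hX hx; exact: mult_seminorm_ge0 hx _.
- by move=> x /hX hx; exact: mult_seminorm1 hvn hx.
- by move=> x f g /hX hx; exact: mult_seminormM hx _ _.
Qed.

Lemma exists_least_boundary_ext : X !=set0 -> exists G', least_boundary X' G'.
Proof.
move=> [x /seminorm_restr_surj[y X'y _]].
apply: exists_least_boundary => //; first by exists y.
- by move=> z f /X'E[hz _]; exact: mult_seminorm_ge0 hz _.
- by move=> z /X'E[hz _]; exact: mult_seminorm1 hv' hz.
- by move=> z f g /X'E[hz _]; exact: mult_seminormM hz _ _.
Qed.

Lemma least_boundary_image G' y : least_boundary X' G' -> G' y ->
  exists2 G, least_boundary X G & G (seminorm_restr y).
Proof.
move=> [bG' G'least] G'y; have X0 : X !=set0.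
  by exists (seminorm_restr y); case: bG' => _ /(_ y G'y)/X'E[].
have [G [bG Gleast]] := exists_least_boundary_restr X0.
exists G => //; exact: (G'least _ (boundary_preimage bG X0) y G'y).2.
Qed.

Lemma least_boundary_lift G x : least_boundary X G -> G x ->
  exists G' y, [/\ least_boundary X' G', G' y & seminorm_restr y = x].
Proof.
move=> [bG Gleast] Gx; have X0 : X !=set0.
  by exists x; case: bG => _ /(_ x Gx).
have [G' [bG' G'least]] := exists_least_boundary_ext X0.
by have [y G'y yx] := Gleast _ (boundary_image bG') x Gx; exists G', y.
Qed.

End BaseChange.

(** * Fibers of the tropicalization *)

Section OrbitProjection.
Variables (R : realType) (n : nat) (K : fieldType) (sigma : cone R n).
Local Notation dual := (dual_monoid sigma).
Local Notation perp := (perp_monoid sigma).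
Local Notation B := (chart_ring K sigma).
Local Notation A := (orbit_ring K sigma).
Implicit Types (f g : B) (u : dual).

Lemma perp_dual (u : 'rV[int]_n) : perp_pred sigma u -> dual_pred sigma u.
Proof. by move=> /asboolP h; apply/asboolP => w /h ->. Qed.

Definition dual_of_perp (u' : perp) : dual := DualMonoid (perp_dual (perp_valP u')).

Lemma mcoeff_orbit_proj f (u' : perp) : (orbit_proj f)@_u' = f@_(dual_of_perp u').
Proof.
rewrite (mcoeffA_sum (P := perp)) [in RHS](malg_sumE f) mcoeffA_sum.
apply: eq_bigr => u _; rewrite mcoeffU; case: insubP => [w _ wE|uperp].
  rewrite mcoeffU; congr (_ *+ (_ : bool)).
  by rewrite -(inj_eq val_inj) wE -(inj_eq val_inj).
rewrite mcoeff0; case: eqP => // uE; move: uperp; rewrite uE /=.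
by rewrite (perp_valP u').
Qed.

Lemma orbit_proj0 : orbit_proj (0 : B) = 0.
Proof. by apply/malgP => u'; rewrite mcoeff_orbit_proj !mcoeff0. Qed.

Lemma orbit_projD : {morph (@orbit_proj R n K sigma) : f g / f + g}.
Proof.
move=> f g; apply/malgP => u'.
rewrite (mcoeffA (P := perp) u' (orbit_proj f) (orbit_proj g)).
transitivity ((f + g)@_(dual_of_perp u')); first exact: mcoeff_orbit_proj.
transitivity (f@_(dual_of_perp u') + g@_(dual_of_perp u')).
  exact: (mcoeffA (P := dual)).
by congr (_ + _); apply/esym; exact: mcoeff_orbit_proj.
Qed.

Lemma orbit_projU c u : orbit_proj (<< c *g u >> : B) =
  if insub (val u) is Some u' then (<< c *g u' >> : A) else 0.
Proof.
apply/malgP => w; rewrite mcoeff_orbit_proj mcoeffU.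
case: insubP => [u' _ u'E|uperp].
  rewrite mcoeffU; congr (_ *+ (_ : bool)).
  by rewrite -[RHS](inj_eq val_inj) u'E -(inj_eq val_inj).
rewrite mcoeff0; case: eqP => // uE; move: uperp; rewrite uE /=.
by rewrite (perp_valP w).
Qed.

Let pairingD (a b : 'rV[int]_n) (w : 'rV[R]_n) : pairing (lattice_vec R (a + b)) w =
  pairing (lattice_vec R a) w + pairing (lattice_vec R b) w.
Proof.
by rewrite /pairing -big_split; apply: eq_bigr => i _; rewrite !mxE intrD mulrDl.
Qed.

(** Two nonnegative numbers with sum zero both vanish: the characters trivial on sigma form a face
    of the dual monoid. This makes [orbit_proj] multiplicative. *)
Lemma perp_predD (u w : dual) :
  perp_pred sigma (val u + val w) = perp_pred sigma (val u) && perp_pred sigma (val w).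
Proof.
have /asboolP u0 := dual_valP u; have /asboolP w0 := dual_valP w.
apply/asboolP/andP => [uw|[/asboolP hu /asboolP hw] z sz]; last first.
  by rewrite pairingD hu// hw// addr0.
split; apply/asboolP => z sz; have := uw z sz; have := u0 z sz; have := w0 z sz;
  rewrite pairingD /=; lra.
Qed.

Lemma orbit_projM : {morph (@orbit_proj R n K sigma) : f g / f * g}.
Proof.
apply: malg_morphM orbit_proj0 orbit_projD _ => a b u w.
transitivity (orbit_proj (<< a * b *g u + w >> : B)).
  by congr orbit_proj; exact: (malg_mulUU (P := dual)).
pose pr c (z : dual) : A :=
  if (insub (val z) : option perp) is Some z' then << c *g z' >> else 0.
transitivity (pr a u * pr b w); last first.
  by congr (_ * _); apply/esym; exact: orbit_projU.
apply: etrans (orbit_projU _ _) _; rewrite /pr.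
have uwD := perp_predD u w.
case: insubP => [x _ xE|uw].
  have /andP[pu pw] : perp_pred sigma (val u) && perp_pred sigma (val w).
    by rewrite -uwD -[_ + _]xE (perp_valP x).
  have {x xE} -> : x = PerpMonoid pu + PerpMonoid pw by apply: val_inj; rewrite xE.
  by rewrite !insubT; apply/esym; exact: (malg_mulUU (P := perp)).
case: insubP => [u' pu _|_]; last by rewrite mul0r.
case: insubP => [w' pw _|_]; last by rewrite mulr0.
by move: uw; rewrite [perp_pred _ _]uwD pu pw.
Qed.

End OrbitProjection.

Lemma orbit_proj_scal (R : realType) (n : nat) (K K' : fieldType)
    (iota : {rmorphism K -> K'}) (sigma : cone R n) (f : chart_ring K sigma) :
  malg_scal iota (orbit_proj f) = orbit_proj (malg_scal iota f : chart_ring K' sigma).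
Proof.
apply/malgP => u; apply: etrans (mcoeff_scal iota (orbit_proj f) u) _.
apply: etrans (congr1 iota (mcoeff_orbit_proj f u)) _.
apply/esym; apply: etrans (mcoeff_orbit_proj _ u) _; exact: mcoeff_scal.
Qed.

Section KPPoint.
Variables (R : realType) (n : nat).

(** The homomorphism has a type depending on the cone; transport along a proof that a cone equals
    itself is trivial by proof irrelevance. *)
Lemma KPPoint_inj (sigma : cone R n) (h h' : dual_monoid sigma -> \bar R) :
  KPPoint h = KPPoint h' -> h = h'.
Proof.
pose hom (p : KP_point R n) (e : KP_cone p = sigma) : dual_monoid sigma -> \bar R :=
  ecast s (dual_monoid s -> \bar R) e (@KP_hom _ _ p).
have homE p q : p = q -> forall e, exists e', @hom p e = @hom q e'.
  by move=> -> e; exists e.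
by move=> /homE/(_ erefl)[e']; rewrite (Prop_irrelevance e' erefl).
Qed.

End KPPoint.

(** * Fibers as compact sets of seminorms, and reduction of series to polynomials *)

Section Fiber.
Variables (R : realType) (n : nat) (K : fieldType) (v : K -> R).
Hypothesis hv : nonarch_abs v.
Variables (Delta : set (cone R n)) (X : forall sigma : cone R n, set (chart_ring K sigma)).
Variables (sigma : cone R n) (w : 'rV[R]_n).
Local Notation perp := (perp_monoid sigma).
Local Notation A := (orbit_ring K sigma).
Local Notation T := (trop_fiber v Delta X w : set {ptws A -> R}).
Implicit Types (u : perp) (y : {ptws A -> R}) (f g : A) (a : perp -> K).

Definition char_abs u : R := expR (- pairing (lattice_vec R (val u)) w).

(** Off the perpendicular monoid both homomorphisms are infinite, so the tropical condition only
    prescribes the values on the characters of the orbit. *)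
Lemma trop_fiberP y : T y <-> [/\ Delta sigma, mult_seminorm v y,
  forall h : chart_ring K sigma, X h -> y (orbit_proj h) = 0 &
  forall u, y << 1 *g u >> = char_abs u].
Proof.
have pv u : orbit_proj (chi K (dual_of_perp u)) = << 1 *g u >>.
  apply: etrans (orbit_projU 1 (dual_of_perp u)) _.
  case: insubP => [x _ xE|]; last by rewrite /= (perp_valP u).
  by have -> : x = u by exact: val_inj.
split=> [[[Ds hy Xy] /KPPoint_inj /funeqP yw]|[Ds hy Xy yw]].
  split => // u; have := yw (dual_of_perp u).
  rewrite pv /= (perp_valP u).
  (* A vanishing character would have an infinite tropical coordinate. *)
  have [y0|y0] := ltP 0 (y << 1 *g u >>); last by [].
  move=> -[yE].
  by rewrite /char_abs -yE opprK lnK.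
split; first by split.
congr KPPoint; apply/funext => u.
rewrite /chi orbit_projU; case: insubP => [u' pu u'E|/negbTE ->]; last first.
  by rewrite /= [y 0](mult_seminorm0 hv hy) lexx.
by rewrite pu /= [y _]yw leNgt expR_gt0 /= expRK u'E opprK.
Qed.

Lemma trop_fiber_mult y : T y -> mult_seminorm v y.
Proof. by move=> /trop_fiberP[]. Qed.

Lemma trop_fiber_monomial y c u : T y -> y << c *g u >> = v c * char_abs u.
Proof.
move=> /trop_fiberP[_ hy _ yu]; rewrite -yu -(mult_seminormZ hy).
by rewrite (malg_scaleU (P := perp)) mulr1.
Qed.

Lemma trop_fiber_sum_le y a (J : {fset perp}) (Q : pred perp) e : T y -> 0 <= e ->
  (forall u, Q u -> v (a u) * char_abs u <= e) ->
  y (\sum_(u <- J | Q u) << a u *g u >>) <= e.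
Proof.
move=> Ty e0 H; apply: (mult_seminorm_sum_le hv (trop_fiber_mult Ty)) => // u Qu.
by rewrite trop_fiber_monomial// H.
Qed.

Lemma char_abs_ge0 u : 0 <= char_abs u. Proof. exact: expR_ge0. Qed.

Let closed_eval_le f g : closed [set y : {ptws A -> R} | y f <= y g].
Proof.
have -> : [set y : {ptws A -> R} | y f <= y g] =
    (fun y : {ptws A -> R} => y f - y g) @^-1` [set r | r <= 0].
  by apply/seteqP; split => y /=; rewrite subr_le0.
apply: preimage_closed; last exact: closed_le.
by move=> y _; apply: continuousB; exact: eval_continuous.
Qed.

Let closed_cont_eq (h h' : {ptws A -> R} -> R) : continuous h -> continuous h' ->
  closed [set y | h y = h' y].
Proof.
move=> ch ch'.
have -> : [set y | h y = h' y] = (fun y => h y - h' y) @^-1` [set r | r = 0].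
  apply/seteqP; split => y /=; first by move=> ->; rewrite subrr.
  by move/eqP; rewrite subr_eq0 => /eqP.
apply: preimage_closed; last exact: closed_eq.
by move=> y _; apply: continuousB; [exact: ch|exact: ch'].
Qed.

Let closed_eval_eq f r : closed [set y : {ptws A -> R} | y f = r].
Proof. by apply: closed_cont_eq => y; [exact: eval_continuous|exact: cst_continuous]. Qed.

Let closed_all (I : Type) (Q : I -> {ptws A -> R} -> Prop) :
  (forall i, closed [set y | Q i y]) -> closed [set y | forall i, Q i y].
Proof.
move=> H; have -> : [set y | forall i, Q i y] = \bigcap_i [set y | Q i y].
  by apply/seteqP; split => [y Qy i _|y Qy i]; [exact: Qy|exact: Qy].
by apply: closed_bigI => i _; exact: H.
Qed.

Lemma closed_trop_fiber : closed T.
Proof.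
have [Ds|Ds] := pselect (Delta sigma); last first.
  have -> : T = set0 by apply/seteqP; split => // y /trop_fiberP[].
  exact: closed0.
(* The maximum is written as a disjunction, so that the ultrametric inequality becomes a union of
   two closed conditions. *)
have -> : T = [set y | forall f, 0 <= y f] `&` [set y | forall c, y c%:A = v c] `&`
    [set y | forall fg : A * A, y (fg.1 + fg.2) <= y fg.1 \/ y (fg.1 + fg.2) <= y fg.2] `&`
    [set y | forall fg : A * A, y (fg.1 * fg.2) = y fg.1 * y fg.2] `&`
    [set y | forall h : chart_ring K sigma, X h -> y (orbit_proj h) = 0] `&`
    [set y | forall u, y << 1 *g u >> = char_abs u].
  apply/seteqP; split => y.
    move=> /trop_fiberP[_ [y0 y1 yD yM] yX yu]; do !split => //=.
    by move=> [f g]; apply/orP; rewrite -le_max; exact: yD.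
  move=> [[[[[y0 y1] yD] yM] yX] yu]; apply/trop_fiberP; split => //; split => //.
    by move=> f g; rewrite le_max; apply/orP; exact: (yD (f, g)).
  by move=> f g; exact: (yM (f, g)).
repeat (apply: closedI); apply: closed_all.
- move=> f.
  have -> : [set y : {ptws A -> R} | 0 <= y f] = (fun y => y f) @^-1` [set r | 0 <= r] by [].
  apply: preimage_closed; last exact: closed_ge.
  by move=> y _; exact: eval_continuous.
- by move=> c; exact: closed_eval_eq.
- by move=> [f g]; apply: closedU; exact: closed_eval_le.
- move=> [f g] /=; apply: closed_cont_eq => y; first exact: eval_continuous.
  by apply: continuousM; exact: eval_continuous.
- by move=> f; apply: closed_all => _; exact: closed_eval_eq.
- by move=> u; exact: closed_eval_eq.
Qed.

(** The values on monomials are fixed, so y f is at most a number depending on f alone, and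
    Tychonoff applies. *)
Lemma compact_trop_fiber : compact T.
Proof.
pose b f : R := \sum_(u <- msupp f) v f@_u * char_abs u.
have cb : compact [set y : {ptws A -> R} | forall f, `[0, b f]%classic (y f)].
  apply: (@tychonoff A (fun=> R) (fun f => `[0, b f]%classic)) => f.
  exact: segment_compact.
apply: (subclosed_compact closed_trop_fiber cb).
move=> y Ty f /=; rewrite in_itv/= (mult_seminorm_ge0 (trop_fiber_mult Ty))/=.
rewrite [in leLHS](malg_sumE (P := perp) f) big_seq.
apply: (mult_seminorm_sum_le hv (trop_fiber_mult Ty)).
  by apply: sumr_ge0 => u _; rewrite mulr_ge0 ?char_abs_ge0 ?(nonarch_abs_ge0 hv).
move=> u us; rewrite trop_fiber_monomial// /b (big_rem u)//= lerDl.
by apply: sumr_ge0 => z _; rewrite mulr_ge0 ?char_abs_ge0 ?(nonarch_abs_ge0 hv).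
Qed.

Lemma affinoid_small a e : affinoid_series v w a -> 0 < e ->
  exists J : {fset perp}, forall u, u \notin J -> v (a u) * char_abs u <= e.
Proof.
move=> ha e0; have /finite_fsetP[J JE] := ha e e0; exists J => u uJ.
rewrite leNgt; apply/negP => /ltW h; move/negP: uJ; apply.
have : [set` J] u by rewrite -JE.
by [].
Qed.

Lemma trop_fiber_trunc_diff a e (J J' : {fset perp}) y : T y -> 0 <= e ->
  (forall u, u \notin J -> v (a u) * char_abs u <= e) -> (J `<=` J')%fset ->
  y (series_trunc a J' - series_trunc a J) <= e.
Proof.
move=> Ty e0 H JJ'; rewrite /series_trunc.
have -> : \sum_(u <- J') (<< a u *g u >> : A) =
    \sum_(u <- J) << a u *g u >> + \sum_(u <- J' | u \notin J) << a u *g u >>.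
  rewrite (bigID (fun u => u \in J)) /=; congr (_ + _).
  by rewrite big_fset_condE; apply: eq_fbigl => u; rewrite !inE /= andbC;
    case: (boolP (u \in J)) => // uJ; rewrite (fsubsetP JJ').
by rewrite addrAC subrr add0r; exact: trop_fiber_sum_le.
Qed.

Lemma trop_fiber_eq f g y : T y -> y (f - g) < y g -> y f = y g.
Proof.
move=> /trop_fiber_mult hy fg; apply/eqP; rewrite eq_le; apply/andP; split.
  have := mult_seminormD hy (f - g) g; rewrite subrK => /le_trans; apply.
  by rewrite ge_max lexx ltW.
have := mult_seminormD hy (g - f) f; rewrite subrK -opprB (mult_seminormN hv hy).
by rewrite le_max => /orP[|//]; rewrite leNgt fg.
Qed.

Definition small_outside a (J : {fset perp}) e :=
  forall u, u \notin J -> v (a u) * char_abs u <= e.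

Lemma series_abs_eq a (J : {fset perp}) y r :
  (forall J' : {fset perp}, (J `<=` J')%fset -> y (series_trunc a J') = r) ->
  series_abs a y = r.
Proof.
have PF : ProperFilter (@totally perp) := totally_filter.
move=> H; apply: (cvg_lim (@Rhausdorff R)); apply: cvg_near_cst.
by exists J => // J' JJ'; exact: H.
Qed.

(** Further terms are at most e, hence do not change an absolute value exceeding e; the net is
    eventually constant. *)
Lemma series_abs_large a J e y : T y -> 0 <= e -> small_outside a J e ->
  e < y (series_trunc a J) -> series_abs a y = y (series_trunc a J).
Proof.
move=> Ty e0 Je ey; apply: (@series_abs_eq _ J) => J' JJ'; apply: trop_fiber_eq => //.
by apply: le_lt_trans ey; exact: trop_fiber_trunc_diff.
Qed.

Lemma trop_fiber_trunc_le a (J J' : {fset perp}) e y : T y -> 0 <= e ->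
  small_outside a J e -> y (series_trunc a J) <= e -> (J `<=` J')%fset ->
  y (series_trunc a J') <= e.
Proof.
move=> Ty e0 Je ye JJ'; have hy := trop_fiber_mult Ty.
have := mult_seminormD hy (series_trunc a J' - series_trunc a J) (series_trunc a J).
rewrite subrK => /le_trans; apply; rewrite ge_max ye andbT.
exact: trop_fiber_trunc_diff.
Qed.

(** Either some truncation exceeds its tail at y and the net is eventually constant, or every
    truncation is dominated by its tail and the limit is 0. *)
Lemma series_abs_small a J e y : affinoid_series v w a -> T y -> 0 <= e ->
  small_outside a J e -> y (series_trunc a J) <= e -> 0 <= series_abs a y <= e.
Proof.
move=> ha Ty e0 Je ye; have hy := trop_fiber_mult Ty.
have [[d [J' [d0 J'd dy]]]|H] := pselect (exists d (J' : {fset perp}),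
    [/\ 0 < d, small_outside a J' d & d < y (series_trunc a J')]).
  have eqJ : y (series_trunc a (J `|` J')%fset) = y (series_trunc a J').
    apply: trop_fiber_eq => //; apply: le_lt_trans dy.
    by apply: trop_fiber_trunc_diff => //; [exact: ltW|exact: fsubsetUr].
  rewrite (series_abs_large Ty (ltW d0) J'd dy) (mult_seminorm_ge0 hy) /= -eqJ.
  by apply: trop_fiber_trunc_le Je ye _ => //; exact: fsubsetUl.
suff -> : series_abs a y = 0 by rewrite lexx.
have PF : ProperFilter (@totally perp) := totally_filter.
apply: (cvg_lim (@Rhausdorff R)); apply/cvgrPdist_le => d d0.
have [J' J'd] := affinoid_small ha d0.
exists J' => // J2 J'J2; rewrite sub0r normrN ger0_norm ?(mult_seminorm_ge0 hy)//.
apply: (@trop_fiber_trunc_le a J') => //; first exact: ltW.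
by rewrite leNgt; apply/negP => dy; apply: H; exists d, J'.
Qed.

Lemma series_abs_poly f y : T y -> series_abs (mcoeff^~ f : perp -> K) y = y f.
Proof.
move=> Ty; apply: (@series_abs_eq _ (msupp f)) => J fJ; congr y.
rewrite [RHS](malg_sumE (P := perp)) /series_trunc; apply/esym.
apply: big_fset_incl => // u _ /mcoeff_outdom ->; exact: monalgU0.
Qed.

Lemma affinoid_series_poly f : affinoid_series v w (mcoeff^~ f : perp -> K).
Proof.
move=> e e0; apply: (@sub_finite_set _ _ [set` msupp f]) => [u /= ue|].
  rewrite -mcoeff_neq0; apply/eqP => fu; move: ue.
  by rewrite fu (nonarch_abs0 hv) mul0r leNgt e0.
exact: finite_fset.
Qed.

(** If a truncation exceeds its tail somewhere on the fiber, a maximum point of this polynomial is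
    one for the series. Otherwise the series vanishes on the whole fiber. *)
Lemma is_boundaryE (G : set {ptws A -> R}) :
  is_boundary v Delta X w G <-> algebraic_boundary T G.
Proof.
split=> [[cG GT Gmax]|[cG GT Gmax]]; split => //.
  move=> f; have [g Gg gmax] := Gmax _ (affinoid_series_poly f).
  exists g => // y Ty; have := gmax y Ty.
  by rewrite !series_abs_poly//; exact: GT.
move=> a ha.
have [[e [J [y [e0 Je Ty ey]]]]|H] := pselect (exists e J y,
    [/\ 0 < e, small_outside a J e, T y & e < y (series_trunc a J)]).
  have [g Gg gmax] := Gmax (series_trunc a J); exists g => // z Tz.
  have eg : e < g (series_trunc a J) by exact: lt_le_trans (gmax y Ty).
  rewrite (series_abs_large (GT _ Gg) (ltW e0) Je eg).
  have [ez|ze] := ltP e (z (series_trunc a J)).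
    by rewrite (series_abs_large Tz (ltW e0) Je ez) gmax.
  by have /andP[_ /le_trans] := series_abs_small ha Tz (ltW e0) Je ze; apply; exact: ltW.
have small0 z d : T z -> 0 < d -> 0 <= series_abs a z <= d.
  move=> Tz d0; have [J Jd] := affinoid_small ha d0.
  apply: (series_abs_small ha Tz (ltW d0) Jd).
  by rewrite leNgt; apply/negP => dz; apply: H; exists d, J, z.
have [g Gg _] := Gmax 0; exists g => // z Tz.
have /andP[g0 _] := small0 g 1 (GT _ Gg) ltr01; apply: le_trans g0.
by apply/ler_addgt0Pr => d d0; rewrite add0r; case/andP: (small0 z d Tz d0).
Qed.

Lemma is_shilov_boundaryE (G : set {ptws A -> R}) :
  is_shilov_boundary v Delta X w G <-> least_boundary T G.
Proof.
split=> -[/is_boundaryE bG H]; split => // G' /is_boundaryE; exact: H.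
Qed.

End Fiber.

(** * Fibers under extension of scalars *)

Section FiberBaseChange.
Variables (R : realType) (K K' : fieldType) (v : K -> R) (v' : K' -> R).
Hypotheses (hv : nonarch_abs v) (hv' : nonarch_abs v').
Variable iota : {rmorphism K -> K'}.
Hypothesis hiota : forall a, v' (iota a) = v a.
Variables (n : nat) (Delta : set (cone R n)).
Variable X : forall sigma : cone R n, set (chart_ring K sigma).

Lemma mult_seminorm_restr (P : nmodType) (y : monoidAlg K' P -> R) :
  mult_seminorm v' y -> mult_seminorm v (seminorm_restr iota y).
Proof.
move=> hy; split=> [f|c|f g|f g]; rewrite /seminorm_restr.
- exact: mult_seminorm_ge0 hy _.
- by rewrite malg_scal_alg; case: hy => _ -> _ _; rewrite hiota.
- by rewrite malg_scalD; exact: mult_seminormD hy _ _.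
- by rewrite malg_scalM; exact: mult_seminormM hy _ _.
Qed.

Lemma trop_fiber_ext (sigma : cone R n) (w : 'rV[R]_n)
    (y : {ptws orbit_ring K' sigma -> R}) :
  trop_fiber v' Delta (subscheme_ext iota X) w y <->
  mult_seminorm v' y /\ trop_fiber v Delta X w (seminorm_restr iota y).
Proof.
split=> [/(trop_fiberP hv')[Ds hy Xy yw]|[hy /(trop_fiberP hv)[Ds _ Xy yw]]].
  split => //; apply/(trop_fiberP hv); split => //.
  - exact: mult_seminorm_restr.
  - move=> h Xh; rewrite /seminorm_restr orbit_proj_scal; apply: Xy.
    by move=> I [_ EI]; apply: EI; exists h.
  - by move=> u; rewrite /seminorm_restr -yw; congr y; rewrite malg_scalU rmorph1.
apply/(trop_fiberP hv'); split => //; last first.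
  by move=> u; rewrite -yw /seminorm_restr; congr y; rewrite malg_scalU rmorph1.
(* The functions vanishing at y form an ideal, so it is enough to look at the generators coming from
   K. *)
move=> h; pose I := [set f : chart_ring K' sigma | y (orbit_proj f) = 0].
apply: (smallest_sub (X := I)); last first.
  by move=> _ [f Xf <-]; rewrite /I /= -orbit_proj_scal; exact: Xy.
split=> [|f g f0 g0|a f f0].
- by apply: etrans (congr1 y (orbit_proj0 K' sigma)) _; exact: mult_seminorm0 hv' hy.
- apply/eqP; rewrite eq_le (mult_seminorm_ge0 hy) andbT.
  have -> : orbit_proj (f + g) = orbit_proj f + orbit_proj g by exact: orbit_projD.
  apply: le_trans (mult_seminormD hy (orbit_proj f) (orbit_proj g)) _.
  by rewrite ge_max; apply/andP; split; [move: f0|move: g0] => /= ->.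
- apply: etrans (congr1 y (orbit_projM a f)) _.
  apply: etrans (mult_seminormM hy (orbit_proj a) (orbit_proj f)) _.
  have {}f0 : y (orbit_proj f) = 0 := f0.
  exact: etrans (congr1 ( *%R (y (orbit_proj a))) f0) (mulr0 _).
Qed.

End FiberBaseChange.

Theorem lemma4p4 (R : realType) (K K' : fieldType) (v : K -> R) (v' : K' -> R)
    (hv : complete_nonarch v) (hv' : complete_nonarch v')
    (iota : {rmorphism K -> K'}) (hiota : forall a, v' (iota a) = v a)
    (n : nat) (Delta : set (cone R n)) (hDelta : pointed_rational_fan Delta)
    (X : forall sigma : cone R n, set (chart_ring K sigma))
    (hX : closed_subscheme Delta X) :
  structural_map iota @` S_Trop v' Delta (subscheme_ext iota X)
  = S_Trop v Delta X.
Proof.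
have hvn := complete_nonarch_abs hv; have hvn' := complete_nonarch_abs hv'.
pose T sigma w : set {ptws orbit_ring K sigma -> R} := trop_fiber v Delta X w.
pose T' sigma w : set {ptws orbit_ring K' sigma -> R} :=
  trop_fiber v' Delta (subscheme_ext iota X) w.
have cT sigma w : compact (T sigma w) by exact: compact_trop_fiber.
have clT sigma w : closed (T sigma w) by exact: closed_trop_fiber.
have cT' sigma w : compact (T' sigma w) by exact: compact_trop_fiber.
have clT' sigma w : closed (T' sigma w) by exact: closed_trop_fiber.
have Tm sigma w x : T sigma w x -> mult_seminorm v x by exact: trop_fiber_mult.
have T'E sigma w y : T' sigma w y <->
    mult_seminorm v' y /\ T sigma w (seminorm_restr iota y).
  exact: trop_fiber_ext.
apply/seteqP; split.
  (* The structural map preserves the cone and the values of characters, so y and its image lie over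
     the same w and a single fiber is considered. *)
  move=> _ [[sigma y] [_ [w [_ [G' /(is_shilov_boundaryE hvn') G'least /= G'y]]]] <-].
  have [G Gleast Gy] := least_boundary_image hv hvn' hiota (cT sigma w) (clT sigma w)
    (cT' sigma w) (clT' sigma w) (@Tm sigma w) (@T'E sigma w) G'least G'y.
  have [xT xw] : T sigma w (seminorm_restr iota y) by case: Gleast => -[_ GT _] _; exact: GT.
  split; first exact: xT.
  exists w; split; first exact: xw.
  by exists G => //; apply/(is_shilov_boundaryE hvn).
move=> [sigma x] [_ [w [_ [G /(is_shilov_boundaryE hvn) Gleast /= Gx]]]].
have [G' [y [G'least G'y yx]]] := least_boundary_lift hv hvn' hiota
  (cT' sigma w) (clT' sigma w) (@Tm sigma w) (@T'E sigma w) Gleast Gx.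
have [yT yw] : T' sigma w y by case: G'least => -[_ GT _] _; exact: GT.
exists (AnPoint y); last by rewrite -yx.
split; first exact: yT.
exists w; split; first exact: yw.
by exists G' => //; apply/(is_shilov_boundaryE hvn').
Qed.
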